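(* Let $D$ be a Dedekind domain that is not a field. Then $\mathrm{Inv}(\mathrm{Int}(D))$ is a free abelian group.
   Context: $\mathrm{Int}(D)=\{f\in K[X]\mid f(D)\subseteq D\}$ is the ring of integer-valued polynomials over $D$, where $K$ is the quotient field of $D$. $\mathrm{Inv}(A)$ is the group of invertible fractional ideals of an integral domain $A$ under multiplication. *)

(* Defs.v *)
From HB Require Import structures.
From mathcomp Require Import all_boot all_order all_algebra.
From mathcomp Require Import boolp classical_sets.
From mathcomp Require Import freeg.

Set Implicit Arguments.
Unset Strict Implicit.
Unset Printing Implicit Defensive.

Import GRing.Theory.
Local Open Scope ring_scope.

Local Notation "x %:F" := (@FracField.tofrac _ x) : ring_scope.

(* Ideals of a ring are {pred D}; by the classical axioms of boolp this covers
   all subsets of D. The library's idealr_closed requires 1 \notin S, so it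
   describes proper ideals. *)

(* Only proper ideals are considered: the unit ideal is generated by 1. *)
Definition noetherian (D : comNzRingType) : Prop :=
  forall S : {pred D}, idealr_closed S ->
  exists s : seq D, forall x, x \in S <->
    exists c : 'I_(size s) -> D, x = \sum_i c i * s`_i.

Definition integrally_closed (D : idomainType) : Prop :=
  forall x : {fraction D}, integralOver (@FracField.tofrac D) x ->
  exists d : D, x = d%:F.

Definition prime_ideal (D : comNzRingType) (P : {pred D}) : Prop :=
  idealr_closed P /\ prime_idealr_closed P.

Definition maximal_ideal (D : comNzRingType) (P : {pred D}) : Prop :=
  idealr_closed P /\
  forall Q : {pred D}, idealr_closed Q -> {subset P <= Q} -> {subset Q <= P}.

(* Fields are allowed here, as usual. *)
Definition dedekind_domain (D : idomainType) : Prop :=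
  [/\ noetherian D, integrally_closed D &
      forall P : {pred D}, prime_ideal P -> (exists2 x, x \in P & x != 0) ->
      maximal_ideal P].

Definition integer_valued (D : idomainType) : {pred {poly {fraction D}}} :=
  fun f => `[< forall d : D, exists e : D, f.[d%:F] = e%:F >].

Section IntegerValuedPolynomials.
Variable D : idomainType.

Lemma integer_valuedP (f : {poly {fraction D}}) :
  reflect (forall d : D, exists e : D, f.[d%:F] = e%:F)
          (f \in @integer_valued D).
Proof. exact: asboolP. Qed.

Fact integer_valued_subring : subring_closed (@integer_valued D).
Proof.
split=> [|f g /integer_valuedP hf /integer_valuedP hg
         |f g /integer_valuedP hf /integer_valuedP hg];
  apply/integer_valuedP => d.
- by exists 1; rewrite hornerC tofrac1.
- have [a fa] := hf d; have [b gb] := hg d.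
  by exists (a - b); rewrite hornerD hornerN fa gb tofracB.
have [a fa] := hf d; have [b gb] := hg d.
by exists (a * b); rewrite hornerM fa gb tofracM.
Qed.

HB.instance Definition _ :=
  GRing.isSubringClosed.Build _ (@integer_valued D) integer_valued_subring.

Record int_poly := IntPoly {
  int_poly_val :> {poly {fraction D}};
  _ : int_poly_val \in @integer_valued D }.

HB.instance Definition _ := [isSub for int_poly_val].
HB.instance Definition _ := [Choice of int_poly by <:].
HB.instance Definition _ := [SubChoice_isSubComNzRing of int_poly by <:].

(* The inverses of {poly {fraction D}} do not restrict to int_poly (a nonzero
   constant is always a unit there), so units are defined intrinsically. *)
Definition int_poly_unit : {pred int_poly} :=
  fun f => `[< exists g : int_poly, g * f = 1 >].

Definition int_poly_inv (f : int_poly) : int_poly :=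
  if pselect (exists g : int_poly, g * f = 1) is left fU
  then projT1 (cid fU) else f.

Fact int_poly_mulVf : {in int_poly_unit, left_inverse 1 int_poly_inv *%R}.
Proof.
move=> f /asboolP fU; rewrite /int_poly_inv.
by case: pselect => // fU'; case: (cid fU').
Qed.

Fact int_poly_unitP (f g : int_poly) : g * f = 1 -> int_poly_unit f.
Proof. by move=> gf; apply/asboolP; exists g. Qed.

Fact int_poly_inv_out : {in [predC int_poly_unit], int_poly_inv =1 id}.
Proof.
move=> f /negP fU; rewrite /int_poly_inv.
by case: pselect => // fU'; case: fU; apply/asboolP.
Qed.

HB.instance Definition _ := GRing.ComNzRing_hasMulInverse.Build int_poly
  int_poly_mulVf int_poly_unitP int_poly_inv_out.

Fact int_poly_integral : GRing.integral_domain_axiom int_poly.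
Proof.
move=> f g /(congr1 val); rewrite rmorphM rmorph0 => /eqP.
by rewrite mulf_eq0 -(rmorph0 (val : int_poly -> _)) !(inj_eq val_inj).
Qed.

HB.instance Definition _ :=
  GRing.ComUnitRing_isIntegral.Build int_poly int_poly_integral.

End IntegerValuedPolynomials.

Section InvertibleIdeals.
Variable A : idomainType.
Local Open Scope classical_set_scope.
Local Notation K := {fraction A}.

Definition fractional_ideal (I : set K) : Prop :=
  [/\ I 0, (forall x y, I x -> I y -> I (x + y)),
      (forall a x, I x -> I (a%:F * x)) &
      exists2 d : A, d != 0 & forall x, I x -> exists a : A, d%:F * x = a%:F].

Definition ideal_mul (I J : set K) : set K :=
  [set x | exists s : seq (K * K),
     (forall p, p \in s -> I p.1 /\ J p.2) /\ x = \sum_(p <- s) p.1 * p.2].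

Definition unit_ideal : set K := range (@FracField.tofrac A).

Definition invertible_ideal (I : set K) : Prop :=
  fractional_ideal I /\
  exists2 J : set K, fractional_ideal J & ideal_mul I J = unit_ideal.

(* (A : I), which is the inverse of I as soon as I is invertible *)
Definition ideal_inv (I : set K) : set K :=
  [set x | forall y, I y -> unit_ideal (x * y)].

Lemma ideal_mul_sub (I J M : set K) :
    M 0 -> (forall x y, M x -> M y -> M (x + y)) ->
    (forall x y, I x -> J y -> M (x * y)) ->
  ideal_mul I J `<=` M.
Proof.
move=> M0 MD IJM x [s [sIJ ->]]; rewrite big_seq.
apply: (big_ind M) => // p /sIJ[]; exact: IJM.
Qed.

Lemma mem_ideal_mul (I J : set K) x y : I x -> J y -> ideal_mul I J (x * y).
Proof.
by move=> Ix Jy; exists [:: (x, y)]; rewrite big_seq1; split=> // p;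
  rewrite inE => /eqP ->.
Qed.

Lemma ideal_mul0 (I J : set K) : ideal_mul I J 0.
Proof. by exists [::]; rewrite big_nil. Qed.

Lemma ideal_mulD (I J : set K) x y :
  ideal_mul I J x -> ideal_mul I J y -> ideal_mul I J (x + y).
Proof.
move=> [s [sIJ ->]] [t [tIJ ->]]; exists (s ++ t); rewrite big_cat; split=> //.
by move=> p; rewrite mem_cat => /orP[/sIJ|/tIJ].
Qed.

Lemma ideal_mulC : commutative ideal_mul.
Proof.
have sub I J : ideal_mul I J `<=` ideal_mul J I.
  apply: ideal_mul_sub => [|x y|x y Ix Jy]; [exact: ideal_mul0
    |exact: ideal_mulD | by rewrite mulrC; apply: mem_ideal_mul].
by move=> I J; apply/seteqP; split; apply: sub.
Qed.

Lemma ideal_mulA : associative ideal_mul.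
Proof.
have sub I J L : ideal_mul (ideal_mul I J) L `<=` ideal_mul I (ideal_mul J L).
  apply: ideal_mul_sub => [|x y|x y IJx Ly];
    [exact: ideal_mul0|exact: ideal_mulD|].
  move: x IJx.
  apply: (ideal_mul_sub (M := [set x | ideal_mul I (ideal_mul J L) (x * y)])).
  - by rewrite /= mul0r; apply: ideal_mul0.
  - by move=> x z /= ? ?; rewrite mulrDl; apply: ideal_mulD.
  - move=> x z Ix Jz /=; rewrite -mulrA.
    by apply: mem_ideal_mul => //; apply: mem_ideal_mul.
move=> I J L; apply/seteqP; split; last exact: sub.
rewrite ideal_mulC (ideal_mulC J L) (ideal_mulC (ideal_mul I J)).
by rewrite (ideal_mulC I J); apply: sub.
Qed.

Lemma ideal_mul1 (I : set K) : fractional_ideal I -> ideal_mul unit_ideal I = I.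
Proof.
move=> [I0 ID IM _]; apply/seteqP; split; last first.
  by move=> x Ix; rewrite -[x]mul1r -tofrac1; apply: mem_ideal_mul => //; exists 1.
apply: ideal_mul_sub => // x y [a _ <-]; exact: IM.
Qed.

Lemma fractional_unit_ideal : fractional_ideal unit_ideal.
Proof.
split.
- by exists 0; rewrite ?tofrac0.
- by move=> _ _ [a _ <-] [b _ <-]; exists (a + b); rewrite ?tofracD.
- by move=> a _ [b _ <-]; exists (a * b); rewrite ?tofracM.
exists 1; first exact: oner_neq0.
by move=> _ [a _ <-]; exists a; rewrite tofrac1 mul1r.
Qed.

Lemma fractional_ideal_mul (I J : set K) :
  fractional_ideal I -> fractional_ideal J -> fractional_ideal (ideal_mul I J).
Proof.
move=> [_ _ IM [c c0 Ic]] [_ _ _ [d d0 Jd]]; split.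
- exact: ideal_mul0.
- by move=> x y; apply: ideal_mulD.
- move=> a.
  apply: (ideal_mul_sub (M := [set x | ideal_mul I J (a%:F * x)])).
  + by rewrite /= mulr0; apply: ideal_mul0.
  + by move=> x z /= ? ?; rewrite mulrDr; apply: ideal_mulD.
  + by move=> x y Ix Jy /=; rewrite mulrA; apply: mem_ideal_mul => //; apply: IM.
exists (c * d); first by rewrite mulf_neq0.
apply: (ideal_mul_sub (M := [set x | exists a : A, (c * d)%:F * x = a%:F])).
- by exists 0; rewrite mulr0 tofrac0.
- by move=> x y /= [a xa] [b yb]; exists (a + b); rewrite mulrDr xa yb tofracD.
move=> x y /Ic[a xa] /Jd[b yb]; exists (a * b).
by rewrite !tofracM mulrACA xa yb.
Qed.

Lemma invertible_unit_ideal : invertible_ideal unit_ideal.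
Proof.
split; first exact: fractional_unit_ideal.
by exists unit_ideal; [|apply: ideal_mul1]; apply: fractional_unit_ideal.
Qed.

Lemma invertible_ideal_mul (I J : set K) :
  invertible_ideal I -> invertible_ideal J -> invertible_ideal (ideal_mul I J).
Proof.
move=> [fI [I' fI' II']] [fJ [J' fJ' JJ']]; split.
  exact: fractional_ideal_mul.
exists (ideal_mul J' I'); first exact: fractional_ideal_mul.
by rewrite -ideal_mulA (ideal_mulA J) JJ' ideal_mul1.
Qed.

Lemma ideal_invE (I J : set K) : fractional_ideal J ->
  ideal_mul I J = unit_ideal -> ideal_inv I = J.
Proof.
move=> [J0 JD JM _] IJ; apply/seteqP; split=> [x Ix|x Jx y Iy]; last first.
  by rewrite -IJ mulrC; apply: mem_ideal_mul.
have : ideal_mul I J 1 by rewrite IJ; exists 1; rewrite ?tofrac1.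
rewrite -[x in J x]mulr1; move: 1.
apply: (ideal_mul_sub (M := [set y | J (x * y)])) => /=.
- by rewrite mulr0.
- by move=> y z ? ?; rewrite mulrDr; apply: JD.
by move=> y z /Ix[a _ xy] Jz; rewrite mulrA -xy; apply: JM.
Qed.

Lemma ideal_mulV (I : set K) :
  invertible_ideal I -> ideal_mul (ideal_inv I) I = unit_ideal.
Proof. by move=> [_ [J fJ IJ]]; rewrite (ideal_invE fJ IJ) ideal_mulC. Qed.

Lemma invertible_ideal_inv (I : set K) :
  invertible_ideal I -> invertible_ideal (ideal_inv I).
Proof.
move=> [fI [J fJ IJ]]; rewrite (ideal_invE fJ IJ); split=> //.
by exists I; rewrite // ideal_mulC.
Qed.

Record InvGroup := InvIdeal {
  InvGroup_val :> set K;
  _ : `[< invertible_ideal InvGroup_val >] }.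

HB.instance Definition _ := [isSub for InvGroup_val].
HB.instance Definition _ := [Choice of InvGroup by <:].

Lemma InvGroupP (I : InvGroup) : invertible_ideal I.
Proof. exact/asboolP/(valP I). Qed.

Definition InvGroup_one : InvGroup := InvIdeal (asboolT invertible_unit_ideal).

Definition InvGroup_mul (I J : InvGroup) : InvGroup :=
  InvIdeal (asboolT (invertible_ideal_mul (InvGroupP I) (InvGroupP J))).

Definition InvGroup_inv (I : InvGroup) : InvGroup :=
  InvIdeal (asboolT (invertible_ideal_inv (InvGroupP I))).

Fact InvGroup_mulA : associative InvGroup_mul.
Proof. by move=> I J L; apply: val_inj; apply: ideal_mulA. Qed.

Fact InvGroup_mulC : commutative InvGroup_mul.
Proof. by move=> I J; apply: val_inj; apply: ideal_mulC. Qed.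

Fact InvGroup_mul1 : left_id InvGroup_one InvGroup_mul.
Proof. by move=> I; apply/val_inj/ideal_mul1; case: (InvGroupP I). Qed.

Fact InvGroup_mulr1 : right_id InvGroup_one InvGroup_mul.
Proof. by move=> I; rewrite InvGroup_mulC InvGroup_mul1. Qed.

Fact InvGroup_mulV : left_inverse InvGroup_one InvGroup_inv InvGroup_mul.
Proof. by move=> I; apply/val_inj/ideal_mulV/InvGroupP. Qed.

Fact InvGroup_mulrV : right_inverse InvGroup_one InvGroup_inv InvGroup_mul.
Proof. by move=> I; rewrite InvGroup_mulC InvGroup_mulV. Qed.

HB.instance Definition _ :=
  isGroup.Build InvGroup InvGroup_mulA InvGroup_mul1 InvGroup_mulr1 InvGroup_mulV InvGroup_mulrV.

End InvertibleIdeals.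

(* {freeg I} is the additive group of finitely supported functions I -> int. *)
Definition free_abelian (G : groupType) : Prop :=
  exists (I : choiceType) (f : {freeg I} -> G),
    {morph f : u v / u + v >-> (u * v)%g} /\ bijective f.

(* Main.v *)
Require Import Defs.
From HB Require Import structures.
From mathcomp Require Import all_boot all_order all_algebra generic_quotient.
From mathcomp Require Import boolp classical_sets wochoice freeg ring zify.

(** Write K for the quotient field of D. For a nonzero prime Q of D pick t in K
    outside D with tQ contained in D: since D is completely integrally closed,
    every nonzero z in K is t^-n times a fraction of elements outside Q, for a
    unique n, and this n is a valuation of z. The ring D is the set of elements
    of K where all these valuations are nonnegative, and each nonzero z has
    bounded valuations.

    Let I be an invertible ideal of Int(D). There is a unique monic rational
    function h such that hI lies in K[X] and contains a nonzero constant. Send I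
    to the multiplicities in h of the irreducible polynomials, together with the
    minima of v(p(a)) for p in hI, for all valuations v as above and all a in D.
    This is a homomorphism to integer-valued functions. Its values are bounded
    because hI and its inverse contain nonzero constants. If I is in the kernel,
    then h = 1 and I as well as its inverse consist of integer-valued
    polynomials, so that I = Int(D).

    Finally every group of bounded functions X -> Z is free (Noebeling). Here the
    subsets of X are well-ordered, a monomial is a product of indicator functions
    with decreasing indices, and monomials are ordered lexicographically. The
    span of the monomials below a given monomial m is such that it contains m as
    soon as it contains a nonzero multiple of m, so leading coefficients are
    well defined and yield a basis. *)

Set Implicit Arguments.
Unset Strict Implicit.
Unset Printing Implicit Defensive.

Import Order.TTheory GRing.Theory Num.Theory.
Local Open Scope ring_scope.
Local Notation "x %:F" := (@FracField.tofrac _ x) : ring_scope.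

(** * Groups of bounded functions *)

Section Monomials.
Variables (X : Type) (E : eqType) (ev : E -> X -> bool) (lt : rel E).
Hypothesis lt_irr : irreflexive lt.
Hypothesis lt_trans : transitive lt.
Hypothesis lt_total : forall x y, [|| lt x y, x == y | lt y x].
Hypothesis lt_wf : well_founded lt.

Definition desc (s : seq E) := pairwise (fun x y => lt y x) s.

Fixpoint lex (s t : seq E) : bool :=
  match s, t with
  | _, [::] => false
  | [::], _ :: _ => true
  | x :: s', y :: t' => lt x y || (x == y) && lex s' t'
  end.

(** The product of the indicators of the letters, hence 1 for the empty word. Since indicators are
    idempotent and commute, decreasing words give all such products. *)
Definition mon (s : seq E) (x : X) : int := (all (ev^~ x) s)%:R.

Inductive spn (P : seq E -> Prop) : (X -> int) -> Prop :=
| spn0 : spn P (fun=> 0)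
| spnS c m f : P m -> spn P f -> spn P (fun x => c * mon m x + f x).

Lemma lex_trans : transitive lex.
Proof.
move=> t s; elim: s t => [|x s IH] [|y t] [|z u] //=.
case/orP=> [xy|/andP[/eqP<- st]] /orP[yz|/andP[/eqP<- tu]].
- by rewrite (lt_trans xy yz).
- by rewrite xy.
- by rewrite yz.
- by rewrite eqxx (IH _ _ st tu) orbT.
Qed.

Lemma lex_total s t : [|| lex s t, s == t | lex t s].
Proof.
elim: s t => [|x s IH] [|y t] //=.
rewrite eqseq_cons; case/or3P: (lt_total x y) => [-> //|/eqP->|->].
  by rewrite lt_irr eqxx /=.
by rewrite !orbT.
Qed.

(** On arbitrary words [lex] need not be well-founded. Here the tail of a decreasing word starts
    with a smaller letter, so it is accessible by induction on the first letter, and an inner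
    induction on the tail treats words with the same first letter. *)
Lemma lex_wf s : desc s -> Acc (fun t u => desc t && lex t u) s.
Proof.
have acc0 : Acc (fun t u => desc t && lex t u) [::].
  by constructor=> -[|y t]; rewrite ?andbF.
case: s => [//|a s]; elim/(well_founded_ind lt_wf): a s => a IHa s /=.
case/andP=> as_ ds.
have As : Acc (fun t u => desc t && lex t u) s.
  by case: s as_ ds => [//|b s] /= /andP[ba _] ds; apply: IHa.
elim: As as_ ds => {}s _ IHs as_ ds.
constructor=> -[//|b t] /=; rewrite -andbA => /and3P[bt dt].
case/orP=> [ba|/andP[/eqP eab ts]]; first by apply: IHa => //=; rewrite bt dt.
by rewrite eab in bt *; apply: IHs; rewrite ?dt ?ts.
Qed.

Lemma spn_sub (P Q : seq E -> Prop) f :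
  (forall m, P m -> Q m) -> spn P f -> spn Q f.
Proof. by move=> PQ; elim=> [|c m g /PQ Pm _ IH]; constructor. Qed.

Lemma spnD P f g : spn P f -> spn P g -> spn P (fun x => f x + g x).
Proof.
move=> + Pg; elim=> [|c m h Pm _ IH].
  by under eq_fun do rewrite add0r.
by under eq_fun do rewrite -addrA; constructor.
Qed.

Lemma spnZ P c f : spn P f -> spn P (fun x => c * f x).
Proof.
elim=> [|d m h Pm _ IH]; first by under eq_fun do rewrite mulr0; constructor.
by under eq_fun do rewrite mulrDr mulrA; constructor.
Qed.

Lemma spnB P f g : spn P f -> spn P g -> spn P (fun x => f x - g x).
Proof.
by move=> Pf /(spnZ (-1)) /(spnD Pf); under eq_fun do rewrite mulN1r.
Qed.

Lemma spn_sum (T : eqType) (s : seq T) P (F : T -> X -> int) :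
  (forall i, i \in s -> spn P (F i)) -> spn P (fun x => \sum_(i <- s) F i x).
Proof.
elim: s => [|i s IH] sP.
  by under eq_fun do rewrite big_nil; constructor.
under eq_fun do rewrite big_cons.
by apply: spnD; [|apply: IH => j js]; apply: sP; rewrite inE ?eqxx ?js ?orbT.
Qed.

Lemma spn_mon (P : seq E -> Prop) m : P m -> spn P (mon m).
Proof.
move=> Pm; have := spnS 1 Pm (spn0 P).
by under eq_fun do rewrite mul1r addr0.
Qed.

Lemma spn_cons (P Q : seq E -> Prop) e f :
  (forall m, P m -> Q (e :: m)) -> spn P f ->
  spn Q (fun x => (ev e x)%:R * f x).
Proof.
move=> PQ; elim=> [|c m h Pm _ IH].
  by under eq_fun do rewrite mulr0; constructor.
rewrite (_ : (fun x => _) = (fun x => c * mon (e :: m) x + (ev e x)%:R * h x)).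
  by constructor=> //; apply: PQ.
apply/funext => x; rewrite /mon /=.
by case: (ev e x) => /=; rewrite ?mul1r ?mul0r ?mulr0 ?addr0.
Qed.

Lemma spn_dep (L : seq E) f x y :
  spn (fun t => {subset t <= L}) f -> {in L, forall b, ev b x = ev b y} ->
  f x = f y.
Proof.
move=> + Lxy; elim=> [//|c m g mL _ ->]; rewrite /mon.
by rewrite (@eq_in_all _ (ev^~ x) (ev^~ y)) // => b /mL /Lxy.
Qed.

(** If g1 interpolates where the first letter e holds and g0 where it fails, then g0 + e (g1 - g0)
    interpolates everywhere. No division occurs, so integer coefficients suffice. *)
Lemma spn_interp (L : seq E) (Y : X -> Prop) (F : X -> int) : desc L ->
  (forall x y, Y x -> Y y -> {in L, forall b, ev b x = ev b y} -> F x = F y) ->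
  exists2 g, spn (fun t => desc t /\ {subset t <= L}) g &
    forall x, Y x -> F x = g x.
Proof.
elim: L Y F => [|e L IH] Y F /=.
  move=> _ FY; case: (pselect (exists x, Y x)) => [[x Yx]|nY]; last first.
    exists (fun=> 0); first by constructor.
    by move=> x Yx; case: nY; exists x.
  exists (fun z => F x * mon [::] z + 0).
    by constructor; [split|constructor].
  by move=> y Yy; rewrite /mon /= mulr1 addr0; apply: FY.
case/andP=> eL dL FY.
have [|g1 g1P g1F] := IH (fun x => Y x /\ ev e x) F dL.
  move=> x y [Yx ex] [Yy ey] xy; apply: FY => // b.
  by rewrite inE => /orP[/eqP->|/xy//]; rewrite ex ey.
have [|g0 g0P g0F] := IH (fun x => Y x /\ ~~ ev e x) F dL.
  move=> x y [Yx ex] [Yy ey] xy; apply: FY => // b.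
  by rewrite inE => /orP[/eqP->|/xy//]; rewrite (negbTE ex) (negbTE ey).
exists (fun x => g0 x + (ev e x)%:R * (g1 x - g0 x)).
  apply: spnD.
    by apply: spn_sub g0P => m [dm mL]; split=> // a /mL; rewrite inE orbC => ->.
  apply: (@spn_cons (fun t => desc t /\ {subset t <= L})); last exact: spnB.
  move=> m [dm mL]; split.
    by rewrite /= -/(desc m) dm andbT; apply/allP => a /mL /(allP eL).
  by move=> a; rewrite !inE => /orP[->//|/mL->]; rewrite orbT.
move=> x Yx; case: (boolP (ev e x)) => ex.
  by rewrite mul1r addrC subrK; apply: g1F.
by rewrite mul0r addr0; apply: g0F.
Qed.

(** A decreasing word below e :: m starts with a letter at most e, so e can occur only in front.
    Words starting with e contribute their tails to [g], the others go to [s]. *)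
Lemma spn_split (L : seq E) e m f :
  spn (fun t => [/\ desc t, {subset t <= e :: L} & lex t (e :: m)]) f ->
  exists s, exists2 g,
    [/\ spn (fun t => desc t /\ {subset t <= L}) s &
        spn (fun t => [/\ desc t, {subset t <= L} & lex t m]) g] &
    forall x, f x = s x + (ev e x)%:R * g x.
Proof.
elim=> [|c t h [dt tL tm] _ [s [g [sP gP] E1]]].
  exists (fun=> 0), (fun=> 0); first by split; constructor.
  by move=> x; rewrite mulr0 addr0.
case: t dt tL tm => [|b t] dt tL tm.
  exists (fun x => c * mon [::] x + s x), g; last by move=> x; rewrite E1 addrA.
  by split=> //; constructor.
have /= /andP[bt dt'] := dt.
have tl : {subset t <= L}.
  move=> a ta; have := tL a; rewrite !inE ta orbT => /(_ isT) /orP[/eqP ae|//].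
  have := tL b; rewrite !inE eqxx => /(_ isT) /orP[/eqP be|bL].
    by have := allP bt _ ta; rewrite ae be lt_irr.
  have eb : lt e b by rewrite -ae; exact: (allP bt).
  move: tm => /= /orP[/(lt_trans eb)|/andP[/eqP be _]]; first by rewrite lt_irr.
  by move: eb; rewrite be lt_irr.
have [be|bne] := eqVneq b e.
  exists s, (fun x => c * mon t x + g x); last first.
    move=> x; rewrite E1 /mon /= be; case: (ev e x) => /=; ring.
  split=> //; constructor=> //; split=> //.
  by move: tm => /=; rewrite be lt_irr eqxx.
exists (fun x => c * mon (b :: t) x + s x), g; last by move=> x; rewrite E1 addrA.
split=> //; constructor=> //; split=> // a; rewrite inE => /orP[/eqP->|/tl//].
by have := tL b; rewrite !inE eqxx (negbTE bne) => /(_ isT).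
Qed.

(* Peeling off the largest letter e, the induction hypothesis is applied to the
   points of e that have a partner outside e agreeing on all smaller letters. *)
Lemma spn_pure_in (L : seq E) (Y : X -> Prop) m (N : int) f :
  desc L -> N != 0 -> desc m -> {subset m <= L} ->
  spn (fun t => [/\ desc t, {subset t <= L} & lex t m]) f ->
  (forall x, Y x -> N * mon m x = f x) ->
  exists2 g, spn (fun t => [/\ desc t, {subset t <= L} & lex t m]) g &
    forall x, Y x -> mon m x = g x.
Proof.
move=> dL N0; elim: L dL Y m f => [|e L IH] /=.
  move=> _ Y [|a m] f _ mL; last by have := mL a; rewrite inE eqxx => /(_ isT).
  (* No word lies below the empty one, so f = 0 and [NY] makes Y empty. *)
  case=> [|c [|??] ? []//] NY; exists (fun=> 0); first exact: spn0.
  by move=> x /NY; rewrite /mon /= mulr1 => /eqP; rewrite (negbTE N0).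
case/andP=> eL dL Y [|a m] f dm mL Pf NY.
  case: Pf NY => [|c [|??] ? []//] NY; exists (fun=> 0); first exact: spn0.
  by move=> x /NY; rewrite /mon /= mulr1 => /eqP; rewrite (negbTE N0).
have /= /andP[am dm'] := dm.
(* If m starts below e, neither m nor any smaller decreasing word contains e, so the induction
   hypothesis applies to L. *)
have [ae|ane] := eqVneq a e; last first.
  have aL : a \in L.
    by have := mL a; rewrite !inE eqxx (negbTE ane) => /(_ isT).
  have ltae : lt a e by exact: (allP eL).
  have sub (b : E) : lt b e -> b \in e :: L -> b \in L.
    by rewrite inE => be /orP[/eqP|//]; move: be => /[swap] ->; rewrite lt_irr.
  have [//||||g gP gY] := IH dL Y (a :: m) f.
  - move=> b bm; apply: sub; last exact: mL.
    move: bm; rewrite inE => /orP[/eqP->//|/(allP am)/lt_trans]; exact.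
  - apply: spn_sub Pf => t [dt tL tm]; split=> // b bt; apply: sub (tL b bt).
    case: t dt tm bt {tL} => [//|c t] /= /andP[ct _] tm.
    have ce : lt c e by case/orP: tm => [/lt_trans->|/andP[/eqP->]].
    by rewrite inE => /orP[/eqP->//|/(allP ct)/lt_trans]; exact.
  - exact: NY.
  exists g => //; apply: spn_sub gP => t [dt tL tm]; split=> // b /tL.
  by rewrite inE orbC => ->.
subst a; have [s [g [sP gP] fE]] := spn_split Pf.
have mL' : {subset m <= L}.
  move=> b bm; have := mL b; rewrite !inE bm orbT => /(_ isT) /orP[/eqP be|//].
  by have := allP am _ bm; rewrite be lt_irr.
have sP' : spn (fun t => {subset t <= L}) s by apply: spn_sub sP => t [].
(* At the partner y the relation reads s(y) = 0, and s takes the same value at x. Hence N times the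
   monomial of m equals g on Y'. *)
pose Y' x := Y x /\ ev e x /\
  exists y, [/\ Y y, ~~ ev e y & {in L, forall b, ev b x = ev b y}].
have [//|g' g'P g'Y] := IH dL Y' m g dm' mL' gP.
  move=> x [Yx [ex [y [Yy ey xy]]]].
  have := NY x Yx; have := NY y Yy; rewrite !fE (spn_dep sP' xy) /mon /= ex.
  by rewrite (negbTE ey) /= mulr0 mul0r mul1r addr0 => <-; rewrite add0r.
(* The difference between the monomial of e :: m and e g'. It vanishes on Y', so on Y it depends
   only on the letters of L and is interpolated by words in L, which all lie below e :: m. *)
pose F x := (ev e x)%:R * (mon m x - g' x).
have FL x y : {in L, forall b, ev b x = ev b y} ->
    mon m x - g' x = mon m y - g' y.
  apply: (@spn_dep L (fun x => mon m x - g' x)); apply: spnB.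
    exact: (@spn_mon (fun t => {subset t <= L})).
  by apply: spn_sub g'P => t [].
have [|s' s'P s'Y] := @spn_interp L Y F dL.
  have F0 x y : Y x -> Y y -> {in L, forall b, ev b x = ev b y} ->
      ev e x -> ~~ ev e y -> F x = F y.
    move=> Yx Yy xy ex ey; rewrite /F (negbTE ey) mul0r ex mul1r.
    by rewrite g'Y ?subrr //; split=> //; split=> //; exists y.
  move=> x y Yx Yy xy.
  case: (boolP (ev e x)) => ex; case: (boolP (ev e y)) => ey.
  - by rewrite /F ex ey (FL _ _ xy).
  - exact: F0.
  - by apply/esym/F0 => // b /xy.
  - by rewrite /F (negbTE ex) (negbTE ey) !mul0r.
exists (fun x => s' x + (ev e x)%:R * g' x); last first.
  move=> x Yx; rewrite -(s'Y x Yx) /F /mon /=.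
  by case: (ev e x) => /=; ring.
apply: spnD.
  apply: spn_sub s'P => t [dt tL]; split=> //.
    by move=> b /tL; rewrite inE orbC => ->.
  case: t dt tL => [//|b t] dt tL /=; rewrite (allP eL) //.
  by apply: tL; rewrite inE eqxx.
apply: spn_cons g'P => t [dt tL tm]; split.
- by rewrite /= -/(desc t) dt andbT; apply/allP => b /tL /(allP eL).
- by move=> b; rewrite !inE => /orP[->//|/tL->]; rewrite orbT.
by rewrite /= eqxx tm orbT.
Qed.

Lemma desc_cover (s : seq E) : exists2 L, desc L & {subset s <= L}.
Proof.
pose le x y := (x == y) || lt y x.
have leT : total le.
  by move=> x y; rewrite /le (eq_sym y); case/or3P: (lt_total x y) => ->;
    rewrite ?orbT.
have letr : transitive le.
  move=> y x z /orP[/eqP->//|yx] /orP[/eqP<-|zy]; rewrite /le ?yx ?orbT //.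
  by rewrite (lt_trans zy yx) orbT.
exists (sort le (undup s)); last by move=> x xs; rewrite mem_sort mem_undup.
have := sort_sorted leT (undup s); rewrite (sorted_pairwise letr) => pw.
have : uniq (sort le (undup s)) by rewrite sort_uniq undup_uniq.
rewrite uniq_pairwise => un; have : pairwise le (sort le (undup s)) &&
  pairwise [rel x y | x != y] (sort le (undup s)) by rewrite pw un.
rewrite -pairwise_relI; apply: sub_pairwise => x y /=.
by case/andP=> /orP[/eqP->|//]; rewrite eqxx.
Qed.

Lemma spn_letters P f : spn P f ->
  exists s : seq E, spn (fun t => P t /\ {subset t <= s}) f.
Proof.
elim=> [|c t g Pt _ [s sP]]; first by exists [::]; constructor.
exists (t ++ s); constructor; first by split=> // a; rewrite mem_cat => ->.
apply: spn_sub sP => u [lu us]; split=> // a /us.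
by rewrite mem_cat orbC => ->.
Qed.

Definition low (m t : seq E) := desc t /\ lex t m.

(** A relation involves finitely many letters only, so the case of a finite alphabet applies, with Y
    all of X. *)
Lemma spn_pure (m : seq E) (N : int) :
  N != 0 -> desc m -> spn (low m) (fun x => N * mon m x) -> spn (low m) (mon m).
Proof.
move=> N0 dm Pf.
have [s sP] := spn_letters Pf.
have [L dL sL] := desc_cover (m ++ s).
have [|||g gP mg] :=
  @spn_pure_in L (fun=> True) m N (fun x => N * mon m x) dL N0 dm.
- by move=> a am; apply: sL; rewrite mem_cat am.
- apply: spn_sub sP => t [[dt tm] ts]; split=> // a /ts ats.
  by apply: sL; rewrite mem_cat ats orbT.
- by [].
rewrite (_ : mon m = g); last by apply/funext => x; apply: mg.
by apply: spn_sub gP => t [].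
Qed.

(** Terms are added one at a time and the larger leading word is kept; its coefficient may cancel to
    0. *)
Lemma spn_lead (P : seq E -> Prop) f : (forall t, P t -> desc t) -> spn P f ->
  f = (fun=> 0) \/
  exists t c, P t /\ spn (low t) (fun x => f x - c * mon t x).
Proof.
move=> Pd; elim=> [|c t h Pt _ [->|[u [d [Pu hu]]]]]; first by left.
  right; exists t, c; split=> //.
  by under eq_fun do rewrite addr0 subrr; constructor.
right; case/or3P: (lex_total t u) => [tu|/eqP tu|ut].
- exists u, d; split=> //; under eq_fun do rewrite -addrA.
  by constructor=> //; split=> //; apply: Pd.
- exists u, (c + d); split=> //; rewrite tu.
  by under eq_fun do rewrite mulrDl opprD addrACA subrr add0r.
exists t, c; split=> //.
rewrite (_ : (fun x => _) = (fun x => d * mon u x + (h x - d * mon u x))).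
  constructor; first by split=> //; apply: Pd.
  apply: spn_sub hu => v [dv vu]; split=> //; exact: lex_trans vu ut.
by apply/funext => x; ring.
Qed.

End Monomials.

(** The well-ordering principle gives unique minima of nonempty subsets. Subsets with two or three
    elements yield the order axioms, and a minimal inaccessible element contradicts itself. *)
Lemma exists_well_founded_order (E : eqType) : exists lt : rel E,
  [/\ irreflexive lt, transitive lt,
      forall x y, [|| lt x y, x == y | lt y x] & well_founded lt].
Proof.
have [R woR] := well_ordering_principle E.
have minR A : nonempty A -> exists z, minimum_of R A z.
  by move=> /woR[z [zA _]]; exists z.
have Rtot x y : R x y || R y x.
  have [|z [/= /orP[/eqP->|/eqP->] zA]] := minR [pred z | (z == x) || (z == y)].
  - by exists x; rewrite inE eqxx.
  - by rewrite zA // inE eqxx orbT.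
  - by rewrite [X in _ || X]zA ?orbT // inE eqxx.
have Rrefl x : R x x by have := Rtot x x; rewrite orbb.
have Ranti x y : R x y -> R y x -> x = y.
  move=> xy yx; have [|z [zA uz]] := woR [pred z | (z == x) || (z == y)].
    by exists x; rewrite inE eqxx.
  rewrite -(uz x); last first.
    by split=> [|t]; rewrite inE ?eqxx // => /orP[/eqP->|/eqP->].
  apply: uz; split=> [|t]; rewrite inE ?eqxx ?orbT //.
  by move=> /orP[/eqP->|/eqP->].
have Rtr x y z : R x y -> R y z -> R x z.
  move=> xy yz.
  have [|t [/= /or3P[]/eqP-> tA]] :=
    minR [pred t | [|| t == x, t == y | t == z]].
  - by exists x; rewrite inE eqxx.
  - by apply: tA; rewrite inE eqxx !orbT.
  - have yx : R y x by apply: tA; rewrite inE eqxx.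
    by rewrite (Ranti x y).
  - have zy : R z y by apply: tA; rewrite inE eqxx orbT.
    by rewrite -(Ranti y z).
exists (fun x y => R x y && (x != y)); split.
- by move=> x; rewrite eqxx andbF.
- move=> y x z /andP[xy nxy] /andP[yz nyz]; rewrite (Rtr x y z) //=.
  by apply: contra nxy => /eqP xz; apply/eqP/Ranti => //; rewrite xz.
- move=> x y; rewrite (eq_sym y); case: (eqVneq x y) => //= _.
    by rewrite orbT.
  by rewrite !andbT.
move=> x; apply: contrapT => nx.
have [|z [zA zmin]] :=
    minR [pred z | `[< ~ Acc (fun x y => R x y && (x != y)) z >]].
  by exists x; apply/asboolP.
move: zA => /asboolP; apply; constructor=> y /andP[yz nyz].
apply: contrapT => ny; move/eqP: nyz; apply; apply: Ranti => //.
by apply: zmin; apply/asboolP.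
Qed.

(** * Freeness of groups of bounded functions *)

Section BoundedFunctions.
Variables (X : Type) (G : groupType) (Phi : G -> X -> int).
Hypothesis PhiM : forall g h x, Phi (g * h)%g x = Phi g x + Phi h x.
Hypothesis Phi_inj : forall g, (forall x, Phi g x = 0) -> g = 1%g.
Hypothesis Phi_bounded :
  forall g, exists N : nat, forall x, (`|Phi g x| <= N)%N.

Lemma comb_Phi g h (c : int) :
  exists k, forall x, Phi k x = Phi g x + c * Phi h x.
Proof.
have Phi1 x : Phi 1%g x = 0.
  by apply: (addrI (Phi 1%g x)); rewrite -PhiM mulg1 addr0.
have PhiV k x : Phi k^-1%g x = - Phi k x.
  by apply/eqP; rewrite -addr_eq0 -PhiM mulVg Phi1.
have PhiX k (n : nat) x : Phi (k ^+ n)%g x = n%:Z * Phi k x.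
  elim: n => [|n IH]; first by rewrite expg0 Phi1 mul0r.
  by rewrite expgS PhiM IH intS mulrDl mul1r.
case: c => n.
  by exists (g * h ^+ n)%g => x; rewrite PhiM PhiX.
by exists (g * (h ^+ n.+1)^-1)%g => x; rewrite PhiM PhiV PhiX NegzE mulNr.
Qed.

(** The level sets of the nonzero values are split off one at a time. *)
Lemma finite_values_spn (E : eqType) (ev : E -> X -> bool) (P : seq E -> Prop)
    (s : seq int) (F : X -> int) :
  (forall A : X -> bool, exists2 e, P [:: e] & ev e =1 A) ->
  (forall x, F x != 0 -> F x \in s) -> spn ev P F.
Proof.
move=> evP; elim: s F => [|c s IH] F Fs.
  rewrite (_ : F = fun=> 0); first exact: spn0.
  by apply/funext => x; apply/eqP/negPn/negP => /Fs.
have [e Pe eE] := evP (fun x => F x == c).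
rewrite (_ : F = fun x => c * mon ev [:: e] x + (if F x == c then 0 else F x)).
  constructor=> //; apply: IH => x.
  case: (eqVneq (F x) c) => [|ne]; first by rewrite eqxx.
  by move=> /Fs; rewrite inE (negbTE ne).
apply/funext => x; rewrite /mon /= andbT eE.
by case: (eqVneq (F x) c) => [->|]; rewrite ?mulr1 ?addr0 ?mulr0 ?add0r.
Qed.

(* The leading coefficients at a fixed monomial m form a subgroup of int;
   an element whose leading coefficient generates it, for every m not spanned
   by smaller monomials, gives a basis. *)
Lemma bounded_free : free_abelian G.
Proof.
(* The letters are all subsets of X, so every level set is a letter. *)
pose E : choiceType := (X -> bool : Type).
have [lt [irr tr tot wf]] := exists_well_founded_order E.
pose ev (e : E) x := e x.
pose lspan m := spn ev (low lt m).
pose leads m c := exists g, lspan m (fun x => Phi g x - c * mon ev m x).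
pose good m := [/\ desc lt m, ~ lspan m (mon ev m) &
  exists2 c, c != 0 & leads m c].
have gen m : good m -> exists p : G * int, [/\ p.2 != 0,
    lspan m (fun x => Phi p.1 x - p.2 * mon ev m x) &
    forall c, leads m c -> exists q, c = q * p.2].
  case=> dm _ [c c0 cm].
  pose pr n := `[< exists2 c : int, leads m c & c != 0 /\ absz c = n >].
  have ex : exists n, pr n by exists (absz c); apply/asboolP; exists c.
  case: (ex_minnP ex) => n /asboolP[b [g gb] [b0 bn]] nmin.
  exists (g, b); split=> // d [h hd]; exists (d %/ b)%Z.
  apply/eqP; rewrite {1}(divz_eq d b) -subr_eq0 addrC addKr; apply/negPn/negP => r0.
  (* The remainder of d by b is again a leading coefficient at m; if nonzero, it contradicts the
     minimality of the absolute value of b. *)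
  have [k kE] := comb_Phi h g (- (d %/ b)%Z).
  have kr : leads m (d %% b)%Z.
    exists k; have := spnB hd (spnZ (d %/ b)%Z gb); congr (spn _ _ _).
    apply/funext => x; rewrite kE {1}(divz_eq d b); ring.
  have : pr (absz (d %% b)%Z) by apply/asboolP; exists (d %% b)%Z.
  move/nmin; rewrite -bn leqNgt => /negP; apply.
  by rewrite -ltz_nat abszE ger0_norm ?modz_ge0 // ltz_mod.
pose I : choiceType := {m : seq E | `[< good m >]}.
have goodP (i : I) : good (val i) by apply/asboolP/(valP i).
pose gb (i : I) := projT1 (cid (gen _ (goodP i))).
have gbP (i : I) : [/\ (gb i).2 != 0,
    lspan (val i) (fun x => Phi (gb i).1 x - (gb i).2 * mon ev (val i) x) &
    forall c, leads (val i) c -> exists q, c = q * (gb i).2].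
  by rewrite /gb; case: cid.
pose beta (u : {freeg I}) x : int := fglift (fun i : I => Phi (gb i).1 x : int^o) u.
have betaB u v x : beta (u - v) x = beta u x - beta v x.
  exact: (lift_is_additive (M := int^o)).
have beta0 x : beta 0 x = 0 by rewrite -(subrr 0) betaB subrr.
have betaD u v x : beta (u + v) x = beta u x + beta v x.
  by rewrite -[v in LHS]opprK betaB -[- v]sub0r betaB beta0 sub0r opprK.
have betaU c i x : beta << c *g i >> x = c * Phi (gb i).1 x.
  exact: (liftU (M := int^o)).
have beta_sum (r : seq I) (c : I -> int) x :
    beta (\sum_(i <- r) << c i *g i >>) x = \sum_(i <- r) c i * Phi (gb i).1 x.
  elim: r => [|i r IH]; first by rewrite !big_nil beta0.
  by rewrite !big_cons betaD IH betaU.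
have beta_Phi u : exists g, forall x, Phi g x = beta u x.
  rewrite -(freeg_sumE u).
  elim: (dom u) => [|i r [g gE]].
    have [k kE] := comb_Phi 1%g 1%g (-1).
    by exists k => x; rewrite kE big_nil beta0 mulN1r subrr.
  have [k kE] := comb_Phi g (gb i).1 (coeff i u).
  by exists k => x; rewrite kE gE big_cons betaD betaU addrC.
have beta_inj u : (forall x, beta u x = 0) -> u = 0.
  move=> u0; apply/eqP; rewrite -dom_eq0; case du: (dom u) => [//|j r].
  (* Let i be the largest word in the support. All other terms lie in the span below it, so the
     relation puts a nonzero multiple of its monomial there, and by purity the monomial itself,
     against goodness. *)
  have [i iu imax] : exists2 i, i \in dom u &
      forall k, k \in dom u -> k != i -> lex lt (val k) (val i).
    have: dom u != [::] by rewrite du.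
    elim: (dom u) => [//|k [|k' s] IH] _.
      by exists k; rewrite ?inE // => k'; rewrite inE => /eqP->; rewrite eqxx.
    have [//|i iks imax] := IH.
    case/or3P: (lex_total irr tot (val k) (val i)) => [ki|/eqP/val_inj ki|ik].
    - exists i; first by rewrite inE iks orbT.
      by move=> l; rewrite inE => /orP[/eqP->//|/imax].
    - exists i; first by rewrite inE iks orbT.
      by move=> l; rewrite inE ki => /orP[/eqP->|/imax//]; rewrite eqxx.
    exists k; first by rewrite inE eqxx.
    move=> l; rewrite inE => /orP[/eqP->|ls _]; first by rewrite eqxx.
    have [->//|li] := eqVneq l i.
    exact: (lex_trans tr) (imax l ls li) ik.
  have [dm nm _] := goodP i; have [n0 gi _] := gbP i.
  case: nm.
  apply: (@spn_pure _ _ ev lt irr tr tot (val i) (coeff i u * (gb i).2)) => //.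
    by rewrite mulf_neq0 // -mem_dom.
  have : lspan (val i)
      (fun x => \sum_(k <- rem i (dom u)) coeff k u * Phi (gb k).1 x).
    apply: spn_sum => k; rewrite mem_rem_uniq ?uniq_dom // => /andP[kni ku].
    have ki := imax k ku kni.
    have [dk _ _] := goodP k; have [_ gk _] := gbP k.
    apply: spnZ.
    have gk' : lspan (val i)
        (fun x => Phi (gb k).1 x - (gb k).2 * mon ev (val k) x).
      by apply: spn_sub gk => t [dt tk]; split=> //; apply: (lex_trans tr) tk ki.
    have mk : lspan (val i) (mon ev (val k)) by apply: spn_mon.
    have := spnD gk' (spnZ (gb k).2 mk).
    by congr (spn _ _ _); apply/funext => x; rewrite subrK.
  move/(spnD (spnZ (coeff i u) gi))/(spnZ (-1)).
  congr (spn _ _ _); apply/funext => x.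
  have := u0 x; rewrite -{1}(freeg_sumE u) beta_sum.
  rewrite (perm_big _ (perm_to_rem iu)) big_cons => /eqP.
  rewrite addr_eq0 -eqr_oppLR eq_sym => /eqP ->; ring.
have beta_sur g : exists u, forall x, Phi g x = beta u x.
  (* Well-founded induction on m. If c = 0 or m is spanned by smaller words, the function has a
     smaller leading word. Otherwise m is good, and subtracting a multiple of its basis element
     removes the leading term. *)
  have low_sur m : desc lt m -> forall g c,
      lspan m (fun x => Phi g x - c * mon ev m x) ->
      exists u, forall x, Phi g x = beta u x.
    move=> dm; move: (lex_wf wf dm) (dm) => {dm}; elim=> {}m _ IH dm {}g c gm.
    have case0 h : lspan m (Phi h) -> exists u, forall x, Phi h x = beta u x.
      case/(spn_lead irr tr tot (fun t => @proj1 _ _)) => [->|[t [d [[dt tm] ht]]]].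
        by exists 0 => x; rewrite beta0.
      by apply: IH ht; rewrite ?dt.
    have gm' : lspan m (mon ev m) \/ c = 0 -> lspan m (Phi g).
      case=> [mm|c0]; last first.
        by move: gm; rewrite c0; under eq_fun do rewrite mul0r subr0.
      by have := spnD gm (spnZ c mm); under eq_fun do rewrite subrK.
    case: (pselect (lspan m (mon ev m))) => [mm|nm].
      by apply/case0/gm'; left.
    have [c0|c0] := eqVneq c 0; first by apply/case0/gm'; right.
    have gdm : good m by split=> //; exists c => //; exists g.
    pose i : I := exist _ m (asboolT gdm).
    have [n0 gi gen_i] := gbP i.
    have [|q cq] := gen_i c; first by exists g.
    have [k kE] := comb_Phi g (gb i).1 (- q).
    have [|u uk] := case0 k.
      have := spnB gm (spnZ q gi); congr (spn _ _ _); apply/funext => x.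
      rewrite kE cq /=; ring.
    exists (u + << q *g i >>) => x; rewrite betaD betaU -uk kE; ring.
  have [N Ng] := Phi_bounded g.
  have : spn ev (desc lt) (Phi g).
    (* Boundedness leaves only the 2N + 1 integers from -N to N as values. *)
    apply: (@finite_values_spn _ _ _ [seq i%:Z - N%:Z | i <- iota 0 (N + N).+1]).
      by move=> A; exists A.
    move=> x _; apply/mapP; exists (absz (Phi g x + N%:Z)); have := Ng x.
      by rewrite mem_iota; lia.
    by lia.
  case/(spn_lead irr tr tot (fun t => id)) => [->|[t [d [dt ht]]]].
    by exists 0 => x; rewrite beta0.
  exact: low_sur ht.
pose f u := projT1 (cid (beta_Phi u)).
have fE u x : Phi (f u) x = beta u x by rewrite /f; case: cid.
have Phi_eq g h : (forall x, Phi g x = Phi h x) -> g = h.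
  move=> gh; have [k kE] := comb_Phi 1%g 1%g (-1).
  have Phi1 x : Phi 1%g x = 0.
    by apply: (addrI (Phi 1%g x)); rewrite -PhiM mulg1 addr0.
  apply: (mulIg h^-1%g); rewrite mulgV; apply: Phi_inj => x.
  by rewrite PhiM gh -PhiM mulgV Phi1.
exists I, f; split.
  by move=> u v; apply: Phi_eq => x; rewrite PhiM !fE betaD.
exists (fun g => projT1 (cid (beta_sur g))) => [u|g]; case: cid => u' /= u'E.
  apply/eqP; rewrite -subr_eq0; apply/eqP/beta_inj => x.
  by rewrite betaB -u'E fE subrr.
by apply: Phi_eq => x; rewrite fE u'E.
Qed.
End BoundedFunctions.

(** * Valuations of a Dedekind domain *)

Lemma fracP (D : idomainType) (z : {fraction D}) :
  exists a b : D, b != 0 /\ z = a%:F / b%:F.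
Proof.
elim/quotW: z => x; have d0 := denom_ratioP x.
exists (frac x).1, (frac x).2; split=> //.
have dF0 : (frac x).2%:F != 0 by rewrite tofrac_eq0.
apply: (mulIf dF0); rewrite divfK //; apply/eqP.
change (FracField.mul (\pi x)%qT (frac x).2%:F == (frac x).1%:F).
rewrite !piE /= /FracField.mulf !numden_Ratio ?oner_neq0 ?mulr1 //.
by rewrite FracField.equivfE !numden_Ratio ?oner_neq0 // mulr1 mulrC.
Qed.

(** The ideal generated by T, as finite combinations. Unlike [idealr_closed], this allows the unit
    ideal. *)
Inductive idl (R : nzRingType) (T : R -> Prop) : R -> Prop :=
| idl0 : idl T 0
| idlS a x y : T x -> idl T y -> idl T (a * x + y).

Section Ideals.
Variable R : comNzRingType.
Implicit Types T U : R -> Prop.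

Lemma idl_sub T U x : (forall y, T y -> U y) -> idl T x -> idl U x.
Proof. by move=> TU; elim=> [|a y z /TU Uy _]; constructor. Qed.

Lemma idlD T x y : idl T x -> idl T y -> idl T (x + y).
Proof.
by elim=> [|a u v Tu _ IH Ty]; rewrite ?add0r // -addrA; constructor; auto.
Qed.

Lemma idlM T a x : idl T x -> idl T (a * x).
Proof.
elim=> [|b u v Tu _]; first by rewrite mulr0; constructor.
by rewrite mulrDr mulrA; constructor.
Qed.

Lemma idl_mem T x : T x -> idl T x.
Proof.
by move=> Tx; rewrite -[x]addr0 -[x]mul1r; constructor=> //; constructor.
Qed.

Lemma idl_finite T x : idl T x ->
  exists2 s : seq R, (forall y, y \in s -> T y) & idl (fun y => y \in s) x.
Proof.
elim=> [|a u v Tu _ [s sT sv]]; first by exists [::] => //; constructor.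
exists (u :: s); first by move=> y; rewrite inE => /orP[/eqP->|/sT].
constructor; first exact: mem_head.
by apply: idl_sub sv => y ys; rewrite inE ys orbT.
Qed.

(** As [noetherian] speaks of proper ideals, the unit ideal is treated apart, by a finite
    combination equal to 1. Otherwise the given generators are replaced by the finitely many
    elements of T in their expressions. *)
Lemma noetherian_generators T : noetherian R ->
  exists2 s : seq R, (forall y, y \in s -> T y) &
    forall x, idl T x -> idl (fun y => y \in s) x.
Proof.
move=> noethR; case: (pselect (idl T 1)) => [T1|nT1].
  have [s sT s1] := idl_finite T1; exists s => // x _.
  by rewrite -[x]mulr1; apply: idlM.
pose S : {pred R} := fun x => `[< idl T x >].
have idS : idealr_closed S.
  split; first by apply/asboolP; constructor.
    by apply/negP => /asboolP.
  move=> a u v /asboolP uT /asboolP vT; apply/asboolP.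
  by apply: idlD => //; apply: idlM.
have [g gP] := noethR S idS.
have [s sT sg] : exists2 s : seq R, (forall y, y \in s -> T y) &
    forall x, x \in g -> idl (fun y => y \in s) x.
  have : forall x, x \in g -> idl T x.
    move=> x /(nthP 0)[i ig <-]; apply/asboolP; apply/gP.
    exists (fun j => (j == Ordinal ig)%:R).
    rewrite (bigD1 (Ordinal ig)) //= eqxx mul1r big1 ?addr0 // => j /negbTE->.
    by rewrite mul0r.
  elim: g {gP} => [|x g IH] gT; first by exists [::].
  have [|s sT sg] := IH; first by move=> y yg; apply: gT; rewrite inE yg orbT.
  have [t tT tx] := idl_finite (gT x (mem_head _ _)).
  exists (t ++ s); first by move=> y; rewrite mem_cat => /orP[/tT|/sT].
  move=> y; rewrite inE => /orP[/eqP->|/sg].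
    by apply: idl_sub tx => z zt; rewrite mem_cat zt.
  by apply: idl_sub => z zt; rewrite mem_cat zt orbT.
exists s => // x Tx.
have /gP[c ->] : x \in S by apply/asboolP.
apply: big_ind => [|y z|i _]; [by constructor|exact: idlD|].
by apply/idlM/sg/mem_nth.
Qed.

End Ideals.

(** * Complete integral closure *)

Section CompleteIntegralClosure.
Variable D : idomainType.
Hypotheses (noethD : noetherian D) (intD : integrally_closed D).
Local Notation K := {fraction D}.

(** The ideal generated by all t^n a is generated by finitely many of them, with exponents below
    some N. So t^N a = q(t) a with q of size at most N, and t is a root of the monic polynomial X^N
    - q. *)
Lemma completely_integrally_closed (t : K) (a : D) : a != 0 ->
  (forall n, exists b : D, t ^+ n * a%:F = b%:F) -> exists b : D, t = b%:F.
Proof.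
move=> a0 tD; apply: intD.
pose T (y : D) := exists n, t ^+ n * a%:F = y%:F.
have [s sT sgen] := noetherian_generators T noethD.
have [N NP] : exists N, forall y, y \in s ->
    exists2 n, (n < N)%N & t ^+ n * a%:F = y%:F.
  elim: s sT {sgen} => [|y s IH] sT; first by exists 0%N.
  have [|N NP] := IH; first by move=> z zs; apply: sT; rewrite inE zs orbT.
  have [n nE] := sT y (mem_head _ _); exists (maxn n.+1 N) => z.
  rewrite inE => /orP[/eqP->|/NP[k kN kE]].
    by exists n => //; rewrite leq_max leqnn.
  by exists k => //; rewrite leq_max kN orbT.
have aF0 : a%:F != 0 by rewrite tofrac_eq0.
have low y : idl (fun y => y \in s) y -> exists2 q : {poly D}, (size q <= N)%N &
    y%:F = (map_poly (@FracField.tofrac D) q).[t] * a%:F.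
  elim=> [|c u v /NP[n nN nE] _ [q qN qE]].
    by exists 0; rewrite ?size_poly0 // map_poly0 horner0 mul0r tofrac0.
  exists (c *: 'X^n + q).
    rewrite (leq_trans (size_polyD _ _)) // geq_max qN andbT.
    by rewrite (leq_trans (size_scale_leq _ _)) // size_polyXn.
  rewrite tofracD tofracM -nE qE rmorphD hornerD mulrDl /=.
  by rewrite map_polyZ map_polyXn hornerZ hornerXn mulrA.
have [b bE] := tD N.
have [|q qN qE] := low b; first by apply: sgen; apply: idl_mem; exists N.
exists ('X^N - q).
  rewrite monicE lead_coefDl ?lead_coefXn // size_polyXn size_polyN ltnS //.
rewrite /root rmorphB /= map_polyXn hornerD hornerN hornerXn subr_eq0.
by apply/eqP/(mulIf aF0); rewrite -qE.
Qed.
End CompleteIntegralClosure.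

(** * Valuations attached to primes *)

Section Valuations.
Variables (D : idomainType) (K : fieldType) (phi : {rmorphism D -> K}).
Hypothesis phi_inj : injective phi.
Hypothesis phi_frac : forall z, exists a b, b != 0 /\ z = phi a / phi b.
Hypothesis phi_cic : forall a t, a != 0 ->
  (forall n, exists b, t ^+ n * phi a = phi b) -> exists b, t = phi b.
Local Notation "x %:F" := (phi x) : ring_scope.

Let phi_eq a b : (a%:F == b%:F) = (a == b). Proof. exact: inj_eq. Qed.
Let phi_eq0 a : (a%:F == 0) = (a == 0).
Proof. by rewrite -(inj_eq phi_inj) rmorph0. Qed.

(** The value at 0 is arbitrary, and a lower bound n replaces the minimum in the ultrametric
    inequality. *)
Definition valuation (v : K -> int) :=
  [/\ forall x y, x != 0 -> y != 0 -> v (x * y) = v x + v y,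
      forall x y n, x != 0 -> y != 0 -> x + y != 0 ->
        n <= v x -> n <= v y -> n <= v (x + y) &
      forall d : D, d != 0 -> 0 <= v d%:F].

(** The element t shows that (D : Q) is larger than D; it plays the part of the inverse of a
    uniformizer. *)
Definition divisorial_prime (Q : {pred D}) (t : K) :=
  [/\ prime_ideal Q, exists2 x, x \in Q & x != 0,
      forall x, x \in Q -> exists b : D, t * x%:F = b%:F &
      ~ exists b : D, t = b%:F].

Section PrimeValuation.
Variables (Q : {pred D}) (t : K).
Hypothesis Qt : divisorial_prime Q t.

Let Q0 : 0 \in Q. Proof. by case: Qt => -[[]]. Qed.
Let Q1 : 1 \notin Q. Proof. by case: Qt => -[[]]. Qed.
Let QM a x : x \in Q -> a * x \in Q.
Proof. by case: Qt => -[[? _ QL] _] _ _ _ xQ; rewrite -[_ * _]addr0 QL. Qed.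
Let Qprime x y : x \notin Q -> y \notin Q -> x * y \notin Q.
Proof.
case: Qt => -[_ Qpr] _ _ _ xQ yQ; apply/negP => /Qpr.
by rewrite (negbTE xQ) (negbTE yQ).
Qed.
Let tQ x : x \in Q -> exists b : D, t * x%:F = b%:F.
Proof. by case: Qt => _ _ + _; apply. Qed.
Let tD : ~ exists b : D, t = b%:F. Proof. by case: Qt. Qed.
Let Qneq0 x : x \notin Q -> x != 0. Proof. by apply: contraNneq => ->. Qed.
Let QX x n : x \notin Q -> x ^+ n \notin Q.
Proof. by move=> xQ; elim: n => [|n IH]; rewrite ?expr0 // exprS Qprime. Qed.

(** Otherwise tQ is contained in Q, so all t^n a with a in Q lie in D, and t lies in D by complete
    integral closure. *)
Lemma divisorial_uniformizer : exists p u : D,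
  [/\ p \in Q, u \notin Q & t * p%:F = u%:F].
Proof.
apply: contrapT => nE; case: Qt => _ [a aQ a0] _ _.
apply: tD; apply: (phi_cic a0) => n.
suff [b _ ->] : exists2 b, b \in Q & t ^+ n * a%:F = b%:F by exists b.
elim: n => [|n [b bQ bE]]; first by exists a; rewrite ?mul1r.
have [c cE] := tQ bQ; exists c; last by rewrite exprS -mulrA bE.
by apply: contrapT => /negP cQ; apply: nE; exists b, c.
Qed.

(** While t^n x stays in Q, multiplying by t stays in D. If it never left Q, complete integral
    closure would put t in D. *)
Lemma divisorial_order (x : D) : x != 0 ->
  exists n : nat, exists2 b, b \notin Q & t ^+ n * x%:F = b%:F.
Proof.
move=> x0; apply: contrapT => nE.
apply: tD; apply: (phi_cic x0) => n.
elim: n => [|n [b bE]]; first by exists x; rewrite mul1r.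
case: (boolP (b \in Q)) => bQ; last by case: nE; exists n, b.
by have [c cE] := tQ bQ; exists c; rewrite exprS -mulrA bE.
Qed.

Let t0 : t != 0.
Proof. by apply: contra_not_neq tD => ->; exists 0; rewrite rmorph0. Qed.

(** The units of the localization of D at Q. *)
Let lunit (z : K) := exists a b, [/\ a \notin Q, b \notin Q & z = a%:F / b%:F].

Let lunitM y z : lunit y -> lunit z -> lunit (y * z).
Proof.
move=> [a [b [aQ bQ ->]]] [c [d [cQ dQ ->]]].
by exists (a * c), (b * d); rewrite !Qprime // !rmorphM mulf_div.
Qed.

Let lunitV z : lunit z -> lunit z^-1.
Proof. by move=> [a [b [aQ bQ ->]]]; exists b, a; rewrite invf_div. Qed.

(** If t^(n+1) = a/b with a and b outside Q, then u^(n+1) b = p^(n+1) a lies in Q, although u and b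
    do not. *)
Let lunit_tX n : lunit (t ^+ n.+1) -> False.
Proof.
have [p [u [pQ uQ tp]]] := divisorial_uniformizer.
move=> [a [b [aQ bQ E]]].
have := Qprime (QX n.+1 uQ) bQ; rewrite (_ : _ * _ = (a * p ^+ n) * p).
  by rewrite QM.
have bF : b%:F != 0 by rewrite phi_eq0 Qneq0.
apply/eqP; rewrite -phi_eq !rmorphM !rmorphXn -tp exprMn E exprSr.
by apply/eqP; field.
Qed.

Let lunit_t (n : int) : lunit (t ^ n) -> n = 0.
Proof.
case: n => [[//|n]|n]; first by move/lunit_tX.
by move/lunitV; rewrite invr_expz NegzE opprK => /lunit_tX.
Qed.

Let exists_order (z : K) : exists n : int, z != 0 -> lunit (t ^ n * z).
Proof.
have [a [b [b0 ->]]] := phi_frac z; have [a0|a0] := eqVneq a 0.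
  by exists 0; rewrite a0 rmorph0 mul0r eqxx.
have [m [c cQ cE]] := divisorial_order a0.
have [n [d dQ dE]] := divisorial_order b0.
exists (m%:Z - n%:Z) => _; exists c, d; split=> //.
by rewrite expfzDr // -exprnN -exprnP mulf_div cE dE.
Qed.

(** The value of z is the unique n for which t^n z is a unit of the localization, so t has value -1.
    The last clause says that nonnegative values mean membership in the localization. *)
Lemma divisorial_valuation : exists v, [/\ valuation v,
  forall d, d \notin Q -> v d%:F = 0 &
  forall z, z != 0 -> 0 <= v z ->
    exists2 s, s \notin Q & exists b : D, s%:F * z = b%:F].
Proof.
pose v z := projT1 (cid (exists_order z)).
have vP z : z != 0 -> lunit (t ^ v z * z) by rewrite /v; case: cid.
have v_uniq z n : z != 0 -> lunit (t ^ n * z) -> v z = n.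
  move=> z0 /lunitV /(lunitM (vP z z0)).
  rewrite invfM mulrACA divff // mulr1 invr_expz -expfzDr // => /lunit_t/eqP.
  by rewrite subr_eq0 => /eqP.
have vM x y : x != 0 -> y != 0 -> v (x * y) = v x + v y.
  move=> x0 y0; apply: v_uniq; first by rewrite mulf_neq0.
  by rewrite expfzDr // mulrACA; apply: lunitM; apply: vP.
have v0 d : d != 0 -> 0 <= v d%:F.
  move=> d0; have [n [b bQ bE]] := divisorial_order d0.
  rewrite (@v_uniq _ n) ?phi_eq0 //; exists b, 1; split=> //.
  by rewrite rmorph1 divr1.
have vQ d : d \notin Q -> v d%:F = 0.
  move=> dQ; apply: v_uniq; first by rewrite phi_eq0 Qneq0.
  by exists d, 1; rewrite expr0z mul1r rmorph1 divr1.
have vt : v t = -1.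
  apply: v_uniq => //; exists 1, 1; split=> //.
  by rewrite exprN1 mulVf // rmorph1 divr1.
have vtX n : v (t ^ n) = - n.
  apply: v_uniq; first by rewrite expfz_neq0.
  by exists 1, 1; rewrite -invr_expz mulVf ?expfz_neq0 // rmorph1 divr1.
have vloc z : z != 0 -> 0 <= v z ->
    exists2 s, s \notin Q & exists b : D, s%:F * z = b%:F.
  move=> z0; case E: (v z) => [n|//] _.
  have [p [u [pQ uQ tp]]] := divisorial_uniformizer.
  have := vP z z0; rewrite E => -[a [b [aQ bQ zE]]].
  (* Since u = t p, the factor u^n supplies the t^n that turns z into a/b. *)
  exists (u ^+ n * b); first by rewrite Qprime // QX.
  exists (p ^+ n * a); rewrite !rmorphM !rmorphXn -tp exprMn.
  transitivity (p%:F ^+ n * b%:F * (t ^+ n * z)); first by ring.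
  have bF : b%:F != 0 by rewrite phi_eq0 Qneq0.
  by rewrite zE; field.
exists v; split=> //; split=> // x y n x0 y0 xy0 nx ny.
have tn0 : t ^ n != 0 by rewrite expfz_neq0.
(* Scaling by t^n lowers values by n, so both summands move into the localization, which is closed
   under sums. *)
have loc z : z != 0 -> n <= v z ->
    exists2 s, s \notin Q & exists b : D, s%:F * (t ^ n * z) = b%:F.
  by move=> z0 nz; apply: vloc; rewrite ?mulf_neq0 // vM // vtX addrC subr_ge0.
have [s sQ [b bE]] := loc x x0 nx; have [r rQ [c cE]] := loc y y0 ny.
have srQ := Qprime sQ rQ.
have : 0 <= v ((s * r)%:F * (t ^ n * (x + y))).
  rewrite (_ : _ * _ = (r * b + s * c)%:F).
    apply: v0; rewrite -phi_eq0.
    rewrite (_ : _%:F = (s * r)%:F * (t ^ n * (x + y))).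
      by rewrite !mulf_neq0 // phi_eq0 Qneq0.
    by rewrite rmorphD !rmorphM -bE -cE; ring.
  by rewrite rmorphD !rmorphM -bE -cE; ring.
rewrite !vM ?mulf_neq0 ?phi_eq0 ?Qneq0 // vtX vQ // add0r addrC subr_ge0 //.
Qed.

End PrimeValuation.

(* Among the conductors of the multiples cz outside D, a maximal one is prime. *)
Lemma exists_divisorial_prime (z : K) : noetherian D ->
  ~ (exists b : D, z = b%:F) ->
  exists Q t, divisorial_prime Q t /\
    forall s : D, (exists b : D, s%:F * z = b%:F) -> s \in Q.
Proof.
move=> noethD zD.
pose C (c s : D) := exists b : D, s%:F * (c%:F * z) = b%:F.
pose out (c : D) := ~ exists b : D, c%:F * z = b%:F.
have CD c x y : C c x -> C c y -> C c (x + y).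
  by move=> [a xa] [b yb]; exists (a + b); rewrite !rmorphD mulrDl xa yb.
have CM c a x : C c x -> C c (a * x).
  by move=> [b xb]; exists (a * b); rewrite !rmorphM -mulrA xb.
have C0 c : C c 0 by exists 0; rewrite rmorph0 mul0r.
have Cl c r s : C c s -> C (r * c) s.
  by move=> [b sb]; exists (r * b); rewrite !rmorphM -sb; ring.
have out1 : out 1 by move=> [b]; rewrite rmorph1 mul1r => zb; apply: zD; exists b.
(* Otherwise choice gives a strictly increasing chain of conductors. Its union is finitely
   generated, hence already reached at some stage N. *)
have [c [oc cmax]] : exists c, out c /\
    forall r, out (r * c) -> forall s, C (r * c) s -> C c s.
  apply: contrapT => nmax.
  have step c : exists c', out c ->
      [/\ out c', forall s, C c s -> C c' s & exists2 s, C c' s & ~ C c s].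
    case: (pselect (out c)) => oc; last by exists c.
    apply: contrapT => nc; apply: nmax; exists c; split=> // r orc s rs.
    apply: contrapT => ns; apply: nc; exists (r * c) => _; split=> //.
      by move=> s'; apply: Cl.
    by exists s.
  pose f c := projT1 (cid (step c)).
  have fP c : out c ->
      [/\ out (f c), forall s, C c s -> C (f c) s & exists2 s, C (f c) s & ~ C c s].
    by rewrite /f; case: cid.
  pose c_ n := iter n f 1.
  have outc n : out (c_ n) by elim: n => //= n /fP[].
  have Cmono m n : (m <= n)%N -> forall s, C (c_ m) s -> C (c_ n) s.
    move=> /subnK <-; elim: (n - m)%N => [//|k IH] s /IH.
    by have [_ + _] := fP _ (outc (k + m)%N); apply.
  have [g gU gen] := noetherian_generators (fun s => exists n, C (c_ n) s) noethD.
  have [N NP] : exists N, forall y, y \in g -> C (c_ N) y.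
    elim: g gU {gen} => [|y g IH] gU; first by exists 0%N.
    have [|N NP] := IH; first by move=> x xg; apply: gU; rewrite inE xg orbT.
    have [n ny] := gU y (mem_head _ _); exists (maxn n N) => x.
    rewrite inE => /orP[/eqP->|/NP]; first by apply: Cmono ny; rewrite leq_maxl.
    by apply: Cmono; rewrite leq_maxr.
  have [_ _ [s sN]] := fP _ (outc N); apply.
  have : idl (fun y => y \in g) s by apply/gen/idl_mem; exists N.+1.
  by elim=> [//|a x y /NP Nx _]; apply: CD; apply: CM.
pose Q : {pred D} := fun s => `[< C c s >].
exists Q, (c%:F * z); split; last first.
  move=> s sz; apply/asboolP; rewrite -[c]mulr1; apply: Cl.
  by rewrite /C rmorph1 mul1r.
split=> //.
- split; first split.
  + by apply/asboolP.
  + by apply/negP => /asboolP[b]; rewrite rmorph1 mul1r => cb; apply: oc; exists b.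
  + by move=> a x y /asboolP Cx /asboolP Cy; apply/asboolP/CD => //; apply: CM.
  (* If x is not in the conductor of cz, then xcz is outside D and y is in its conductor, which by
     maximality is no larger. *)
  + move=> x y /asboolP xy; apply/orP.
    case: (pselect (C c x)) => Cx; [by left; apply/asboolP|right].
    apply/asboolP/(cmax x).
      by move=> [b xb]; apply: Cx; exists b; rewrite -xb rmorphM mulrA.
    by case: xy => b xyb; exists b; rewrite -xyb !rmorphM; ring.
- have [a [b [b0 zE]]] := phi_frac z; exists b => //; apply/asboolP.
  exists (c * a); rewrite zE rmorphM.
  have bF0 : b%:F != 0 by rewrite phi_eq0.
  by field.
- by move=> x /asboolP[b xb]; exists b; rewrite mulrC.
Qed.

(** [V] has one valuation for each divisorial prime. All denominators of a fraction outside D lie in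
    such a prime, where its value must then be negative. Boundedness is reduced to elements d of
    D. *)
Lemma valuations_of_fractions : noetherian D ->
  (forall P : {pred D}, prime_ideal P -> (exists2 x, x \in P & x != 0) ->
    maximal_ideal P) ->
  exists V : (K -> int) -> Prop,
  [/\ forall v, V v -> valuation v,
      forall z, z != 0 -> (forall v, V v -> 0 <= v z) -> exists b : D, z = b%:F &
      forall z, z != 0 -> exists N : nat, forall v, V v -> (`|v z| <= N)%N].
Proof.
move=> noethD maxD.
(* The choice depends on Q alone, so equal primes get the same valuation; other sets get a default
   pair. *)
have exv (Q : {pred D}) : exists p : K * (K -> int),
  (exists t, divisorial_prime Q t) ->
  [/\ divisorial_prime Q p.1, valuation p.2,
      forall d, d \notin Q -> p.2 d%:F = 0 &
      forall z, z != 0 -> 0 <= p.2 z ->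
        exists2 s, s \notin Q & exists b : D, s%:F * z = b%:F].
  case: (pselect (exists t, divisorial_prime Q t)) => [[t Qt]|nQ]; last first.
    by exists (0, fun=> 0).
  have [v [vv vQ vloc]] := divisorial_valuation Qt.
  by exists (t, v).
pose p Q := projT1 (cid (exv Q)).
have pP Q : (exists t, divisorial_prime Q t) -> [/\ divisorial_prime Q (p Q).1,
    valuation (p Q).2, forall d, d \notin Q -> (p Q).2 d%:F = 0 &
    forall z, z != 0 -> 0 <= (p Q).2 z ->
      exists2 s, s \notin Q & exists b : D, s%:F * z = b%:F].
  by rewrite /p; case: cid.
pose V v := exists2 Q, exists t, divisorial_prime Q t & v = (p Q).2.
have bound (d : D) : d != 0 -> exists N : nat, forall v, V v -> (`|v d%:F| <= N)%N.
  move=> d0; have dF0 : d%:F != 0 :> K by rewrite phi_eq0.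
  (* Write t_P for the element chosen with P. Finitely many t_P d generate the ideal of all of them,
     for P containing d, and N will bound the values of d at these finitely many primes. *)
  pose T y := exists Q,
    [/\ exists t, divisorial_prime Q t, d \in Q & (p Q).1 * d%:F = y%:F].
  have [s sT gen] := noetherian_generators T noethD.
  have [N NP] : exists N, forall y, y \in s -> exists Q,
      [/\ exists t, divisorial_prime Q t, (p Q).1 * d%:F = y%:F &
          (`|(p Q).2 d%:F| <= N)%N].
    elim: s sT {gen} => [|y s IH] sT; first by exists 0%N.
    have [|N NP] := IH; first by move=> x xs; apply: sT; rewrite inE xs orbT.
    have [Q [Qt _ Qy]] := sT y (mem_head _ _).
    exists (maxn `|(p Q).2 d%:F| N) => x.
    rewrite inE => /orP[/eqP->|/NP[P [Pt Px PN]]].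
      by exists Q; split; rewrite ?leq_maxl.
    by exists P; split=> //; rewrite leq_max PN orbT.
  exists N => _ [Q Qt ->]; have [Qd _ vQ _] := pP Q Qt.
  case: (boolP (d \in Q)) => dQ; last by rewrite vQ.
  rewrite leqNgt; apply/negP => Nlt.
  have [[idQ Qpr] _ tQ _] := Qd; have [Q0 Q1 QL] := idQ.
  have Qprime x y : x \notin Q -> y \notin Q -> x * y \notin Q.
    by move=> xQ yQ; apply/negP => /Qpr; rewrite (negbTE xQ) (negbTE yQ).
  (* For y = t_P d the primes P and Q differ by their values at d, so maximality of P gives r in P
     outside Q. Then r t_P lies in D and r y in dD. *)
  have sep y : y \in s -> exists2 r, r \notin Q & exists e, r * y = d * e.
    move=> /NP[P [Pt Py PN]]; have [[primeP nzP tP _] _ _ _] := pP P Pt.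
    have [r rP rQ] : exists2 r, r \in P & r \notin Q.
      apply: contrapT => nr.
      have PQ : {subset P <= Q}.
        by move=> r rP; apply/negPn/negP => rQ; apply: nr; exists r.
      have QP : {subset Q <= P} by case: (maxD P primeP nzP) => _; apply.
      have eQP : Q = P.
        by apply/funext => x; apply/idP/idP; [apply: QP|apply: PQ].
      by move: Nlt; rewrite eQP ltnNge PN.
    have [b rb] := tP r rP; exists r => //; exists b; apply/eqP.
    by rewrite -phi_eq !rmorphM -Py -rb; apply/eqP; ring.
  have [c cE] := tQ d dQ.
  have [r rQ [e rc]] : exists2 r, r \notin Q & exists e, r * c = d * e.
    have : idl (fun y => y \in s) c by apply/gen/idl_mem; exists Q.
    elim=> [|a x y /sep[r rQ [e re]] _ [r' r'Q [e' re']]].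
      by exists 1 => //; exists 0; rewrite !mulr0.
    exists (r * r'); first exact: Qprime.
    exists (r' * a * e + r * e').
    transitivity (r' * a * (r * x) + r * (r' * y)); first by ring.
    by rewrite re re'; ring.
  (* Now r t_Q = e lies in D, so r u = r t_Q x = e x lies in Q, although r and u do not. *)
  have [x [u [xQ uQ xu]]] := divisorial_uniformizer Qd.
  have := Qprime r u rQ uQ; rewrite (_ : r * u = e * x + 0) ?QL //.
  apply/eqP; rewrite addr0 -phi_eq; apply/eqP/(mulfI dF0).
  have rcF : r%:F * c%:F = d%:F * e%:F by rewrite -!rmorphM rc.
  rewrite !rmorphM -xu; transitivity (r%:F * c%:F * x%:F).
    by rewrite -cE; ring.
  by rewrite rcF; ring.
exists V; split=> [_ [Q Qt ->]|z z0 zV|z z0]; first by have [] := pP Q Qt.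
  apply: contrapT => nz.
  have [Q [t [Qt cond]]] := exists_divisorial_prime noethD nz.
  have [_ _ _ vloc] := pP Q (ex_intro _ t Qt).
  have [|s sQ /cond] := vloc z z0; last by rewrite (negbTE sQ).
  by apply: zV; exists Q => //; exists t.
have [a [b [b0 zE]]] := phi_frac z.
have bF0 : b%:F != 0 :> K by rewrite phi_eq0.
have zb : z * b%:F = a%:F by rewrite zE divfK.
have a0 : a != 0 by rewrite -phi_eq0 -zb mulf_neq0.
have [Na aN] := bound a a0; have [Nb bN] := bound b b0.
exists (Na + Nb)%N => v Vv; have [Q Qt vE] := Vv.
have [_ [vM _ _] _ _] := pP Q Qt; rewrite -vE in vM.
have := aN v Vv; have := bN v Vv; rewrite -zb vM //; lia.
Qed.

End Valuations.

Lemma dedekind_valuations (D : idomainType) : dedekind_domain D ->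
  exists V : ({fraction D} -> int) -> Prop,
  [/\ forall v, V v -> valuation (@FracField.tofrac D) v,
      forall z, z != 0 -> (forall v, V v -> 0 <= v z) ->
        exists b : D, z = (@FracField.tofrac D) b &
      forall z, z != 0 -> exists N : nat, forall v, V v -> (`|v z| <= N)%N].
Proof.
case=> noethD intD maxD; apply: valuations_of_fractions => //.
- by move=> a b /eqP; rewrite tofrac_eq => /eqP.
- exact: fracP.
by move=> a t; apply: completely_integrally_closed.
Qed.

(** * Multiplicities of polynomials *)

Section Multiplicity.
Variable K : fieldType.
Implicit Types f g q : {poly K}.

(** Exponents below the size of f suffice for irreducible q and nonzero f, as q^i has degree at
    least i. *)
Definition mult q f : nat := \max_(i < size f | q ^+ i %| f) i.

Lemma mult_geq q f n : irreducible_poly q -> f != 0 ->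
  (n <= mult q f)%N = (q ^+ n %| f).
Proof.
move=> qi f0; have [q1 _] := qi.
have small i : q ^+ i %| f -> (i < size f)%N.
  move/(dvdp_leq f0); apply: leq_trans.
  rewrite (polySpred (expf_neq0 i (irredp_neq0 qi))) size_exp ltnS leq_pmull //.
  by case: (size q) q1 => [|[]].
apply/idP/idP => [|qf]; last first.
  exact: (@leq_bigmax_cond _ (fun i : 'I_(size f) => q ^+ i %| f) val
    (Ordinal (small n qf))).
move=> nm; apply: dvdp_trans (dvdp_exp2l q nm) _.
apply: (big_ind (fun m => q ^+ m %| f)) => // [|x y qx qy]; first exact: dvd1p.
by case: (leqP x y).
Qed.

Lemma mult_unique q f n r : irreducible_poly q -> r != 0 -> ~~ (q %| r) ->
  f = q ^+ n * r -> mult q f = n.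
Proof.
move=> qi r0 qr fE; have q0 := irredp_neq0 qi.
have f0 : f != 0 by rewrite fE mulf_neq0 ?expf_neq0.
apply/eqP; rewrite eqn_leq andbC mult_geq // fE dvdp_mulr //= leqNgt.
by rewrite -fE mult_geq // fE exprSr dvdp_mul2l ?expf_neq0.
Qed.

Lemma mult_factor q f : irreducible_poly q -> f != 0 ->
  exists r, [/\ r != 0, ~~ (q %| r) & f = q ^+ mult q f * r].
Proof.
move=> qi f0; have := leqnn (mult q f); rewrite mult_geq // => /dvdpP[r fE].
have r0 : r != 0 by apply: contraNneq f0 => r0; rewrite fE r0 mul0r.
exists r; split=> //; last by rewrite mulrC.
apply/negP => qr; have := ltnn (mult q f); rewrite mult_geq // {2}fE exprS.
by rewrite dvdp_mul.
Qed.

Lemma multM q f g : irreducible_poly q -> f != 0 -> g != 0 ->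
  mult q (f * g) = (mult q f + mult q g)%N.
Proof.
move=> qi f0 g0; have [r [r0 qr fE]] := mult_factor qi f0.
have [s [s0 qs gE]] := mult_factor qi g0.
apply: (mult_unique (r := r * s)) => //; first by rewrite mulf_neq0.
  rewrite Gauss_dvdpr //; apply/coprimepP => d dq dr.
  by case: (irredp_XsubCP qi dq) => // /eqp_dvdl dE; rewrite -dE dr in qr.
by rewrite {1}fE {1}gE exprD mulrACA.
Qed.

Lemma mult_leq_size q f : (mult q f <= size f)%N.
Proof. by apply/bigmax_leqP => i _; apply/ltnW. Qed.

Lemma irreducible_factor f : (1 < size f)%N ->
  exists2 q, irreducible_poly q & q %| f.
Proof.
have [n] := ubnP (size f); elim: n f => // n IH f fn f1.
case: (pselect (irreducible_poly f)) => [fi|nf]; first by exists f.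
have [g [g1 gf ng]] : exists g, [/\ size g != 1%N, g %| f & ~~ (g %= f)].
  apply: contrapT => ng; apply: nf; split=> // g g1 gf.
  by apply/negPn/negP => gnf; apply: ng; exists g.
have f0 : f != 0 by rewrite -size_poly_gt0 (leq_trans _ f1).
have g0 : g != 0 by apply: contraNneq f0 => g0; move: gf; rewrite g0 dvd0p.
have [||q qi qg] := IH g; last by exists q => //; apply: dvdp_trans qg gf.
  rewrite (leq_trans _ (ltnSE fn)) // ltn_neqAle dvdp_leq // andbT.
  by apply: contraNneq ng => /eqP; rewrite dvdp_size_eqp.
by rewrite ltn_neqAle eq_sym g1 size_poly_gt0.
Qed.

(** Common irreducible factors are cancelled by induction on the size. Equality is weakened to [%=]
    because the cofactors need not be monic. *)
Lemma monic_eq_mult f g : f \is monic -> g \is monic ->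
  (forall q, irreducible_poly q -> mult q f = mult q g) -> f = g.
Proof.
move=> fm gm fg.
suff: f %= g by rewrite eqp_monic // => /eqP.
have := monic_neq0 fm; have := monic_neq0 gm; move: fg => {fm gm}.
have [n] := ubnP (size f); elim: n f g => // n IH f g fn fg g0 f0.
have half (h k : {poly K}) : h != 0 -> k != 0 ->
    (forall q, irreducible_poly q -> mult q h = mult q k) ->
    (1 < size h)%N -> exists q, [/\ irreducible_poly q, q %| h & q %| k].
  move=> h0 k0 hk /irreducible_factor[q qi qh]; exists q; split=> //.
  by rewrite -[q]expr1 -mult_geq // -hk // mult_geq // expr1.
have common q : irreducible_poly q -> q %| f -> q %| g -> f %= g.
  move=> qi /dvdpP[f' fE] /dvdpP[g' gE].
  have [q1 _] := qi; have q0 := irredp_neq0 qi.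
  have f'0 : f' != 0 by apply: contraNneq f0 => e; rewrite fE e mul0r.
  have g'0 : g' != 0 by apply: contraNneq g0 => e; rewrite gE e mul0r.
  rewrite fE gE eqp_mul2r //; apply: IH => //.
    rewrite (leq_trans _ (ltnSE fn)) // fE size_mul // -subn1.
    move: q1 f'0; rewrite -size_poly_gt0; case: (size q) => [|[|k]] // _.
    by rewrite !addnS subn1 /= ltnS leq_addr.
  move=> p pi; have := fg p pi; rewrite fE gE !multM //; exact: addIn.
have [f1|f1] := ltnP 1 (size f).
  by have [q [qi qf qg]] := half _ _ f0 g0 fg f1; apply: common qi qf qg.
have [g1|g1] := ltnP 1 (size g).
  have [q [qi qg qf]] := half _ _ g0 f0 (fun q qi => esym (fg q qi)) g1.
  exact: common qi qf qg.
have s1 (h : {poly K}) : h != 0 -> (size h <= 1)%N -> h %= 1.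
  by move=> h0 h1; rewrite -size_poly_eq1 eqn_leq h1 size_poly_gt0.
by rewrite (eqp_trans (s1 f f0 f1)) // eqp_sym s1.
Qed.
End Multiplicity.

(** * Extension of an embedding to fraction fields *)

Lemma fraction_morphism (A B : idomainType) (j : {rmorphism A -> B}) :
  injective j -> exists iota : {rmorphism {fraction A} -> {fraction B}},
    forall a, iota a%:F = (j a)%:F.
Proof.
move=> jinj.
(* Quantifying over all representations of z makes its image independent of them. *)
have ex z : exists w : {fraction B}, forall a b : A, b != 0 -> z = a%:F / b%:F ->
    w = (j a)%:F / (j b)%:F.
  have [a [b [b0 zE]]] := fracP z; exists ((j a)%:F / (j b)%:F) => c d d0 zE'.
  have j0 e : e != 0 -> (j e)%:F != 0.
    by move=> e0; rewrite tofrac_eq0 -(rmorph0 j) (inj_eq jinj).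
  apply/eqP; rewrite eqr_div ?j0 // -!tofracM tofrac_eq -!rmorphM (inj_eq jinj).
  by rewrite -tofrac_eq !tofracM -eqr_div ?tofrac_eq0 // -zE -zE'.
pose iota z := projT1 (cid (ex z)).
have iotaP z a b : b != 0 -> z = a%:F / b%:F -> iota z = (j a)%:F / (j b)%:F.
  by rewrite /iota; case: cid => w; apply.
have j0 e : e != 0 -> (j e)%:F != 0.
  by move=> e0; rewrite tofrac_eq0 -(rmorph0 j) (inj_eq jinj).
have iotaF a : iota a%:F = (j a)%:F.
  by rewrite (@iotaP _ a 1) ?oner_neq0 ?tofrac1 ?divr1 // rmorph1 tofrac1 divr1.
have iotaB : zmod_morphism iota.
  move=> x y; have [a [b [b0 xE]]] := fracP x; have [c [d [d0 yE]]] := fracP y.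
  rewrite (iotaP _ _ _ b0 xE) (iotaP _ _ _ d0 yE) (@iotaP _ (a * d - c * b) (b * d)).
  - by rewrite !rmorphB !rmorphM -[- (_ / _)]mulNr addf_div ?j0 // mulNr.
  - by rewrite mulf_neq0.
  by rewrite xE yE rmorphB !rmorphM -[- (_ / _)]mulNr addf_div ?tofrac_eq0 // mulNr.
have iotaM : monoid_morphism iota.
  split; first by rewrite -tofrac1 iotaF rmorph1 tofrac1.
  move=> x y; have [a [b [b0 xE]]] := fracP x; have [c [d [d0 yE]]] := fracP y.
  rewrite (iotaP _ _ _ b0 xE) (iotaP _ _ _ d0 yE) (@iotaP _ (a * c) (b * d)).
  - by rewrite !rmorphM mulf_div.
  - by rewrite mulf_neq0.
  by rewrite xE yE !tofracM mulf_div.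
pose m1 := GRing.isZmodMorphism.Build _ _ iota iotaB.
pose m2 := GRing.isMonoidMorphism.Build _ _ iota iotaM.
pose F : {rmorphism {fraction A} -> {fraction B}} := HB.pack iota m1 m2.
exists F. exact: iotaF.
Qed.

(** * Invertible ideals *)

Section ValuedPolynomialRing.
Variables (A : idomainType) (K F : fieldType) (j : {rmorphism A -> {poly K}}).
Variables (tof : {rmorphism {poly K} -> F}) (iota : {rmorphism {fraction A} -> F}).
Hypothesis tof_inj : injective tof.
Hypothesis iotaF : forall a, iota a%:F = tof (j a).
Hypothesis denomA :
  forall p, exists c a b, [/\ c != 0, j a = c%:P & j b = c%:P * p].

Local Notation B := {poly K}.
Implicit Types (I J : set {fraction A}) (f g p q : B).

(* The elements of K[X] in the fractional ideal (f/g)I. *)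
Definition scaled I f g p := exists2 x, I x & iota x * tof f = tof p * tof g.

(** The rational function h = f/g is kept as a pair of monic polynomials, not necessarily coprime;
    two pairs are compared by cross-multiplication. *)
Definition unitary_scaling I f g :=
  [/\ f \is monic, g \is monic,
      forall x, I x -> exists p, iota x * tof f = tof p * tof g &
      exists2 c : K, c != 0 & scaled I f g c%:P].

Let tof_neq0 p : p != 0 -> tof p != 0.
Proof. by rewrite -(inj_eq tof_inj) rmorph0. Qed.

Let scale_swap (x f g c f' : F) : x * f = c * g -> c * (f' * g) = (x * f') * f.
Proof. by move=> E; rewrite mulrAC E; ring. Qed.

Lemma scaled_eq I f g f' g' p : g \is monic -> f * g' = f' * g ->
  scaled I f g p -> scaled I f' g' p.
Proof.
move=> gm fg [x Ix xp]; exists x => //.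
apply: (mulIf (tof_neq0 (monic_neq0 gm))).
have := congr1 tof fg; rewrite !rmorphM => tfg.
by rewrite -mulrA -tfg mulrA xp mulrAC.
Qed.

(** The constant in each scaled ideal shows that the two rational functions differ by polynomial
    factors both ways. The product of these factors is constant, so each is, and monicity makes the
    ratio 1. *)
Lemma unitary_scaling_unique I f g f' g' :
  unitary_scaling I f g -> unitary_scaling I f' g' -> f * g' = f' * g.
Proof.
move=> [fm gm fg [c c0 [x Ix xc]]] [f'm g'm fg' [c' c'0 [y Iy yc]]].
have [p yp] := fg y Iy; have [q xq] := fg' x Ix.
have E1 : c%:P * (f' * g) = q * (f * g').
  apply: tof_inj; rewrite !rmorphM (scale_swap _ xc) xq; ring.
have E2 : c'%:P * (f * g') = p * (f' * g).
  apply: tof_inj; rewrite !rmorphM (scale_swap _ yc) yp; ring.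
have m1 : f' * g \is monic by rewrite monicMl.
have m2 : f * g' \is monic by rewrite monicMl.
have pq : p * q = (c * c')%:P.
  apply/(mulIf (monic_neq0 m1))/(mulIf (monic_neq0 m2)).
  rewrite polyCM; transitivity ((q * (f * g')) * (p * (f' * g))); first by ring.
  by rewrite -E1 -E2; ring.
have : size q == 1%N.
  have : size (p * q) == 1%N by rewrite pq size_polyC mulf_neq0.
  by rewrite size_mul_eq1 => /andP[].
case/size_poly1P => k k0 qk.
move: E1; rewrite qk => /esym E1; have := congr1 lead_coef E1.
rewrite !lead_coefM !lead_coefC !(monicP _) // !mulr1 => kc.
by move: E1; rewrite kc; apply/mulfI; rewrite polyC_eq0.
Qed.

Lemma unitary_scaling_mul I J f g f' g' :
  unitary_scaling I f g -> unitary_scaling J f' g' ->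
  unitary_scaling (ideal_mul I J) (f * f') (g * g').
Proof.
move=> [fm gm fg [c c0 [x Ix xc]]] [f'm g'm fg' [c' c'0 [y Jy yc]]].
split; [by rewrite monicMl|by rewrite monicMl| |].
  apply: ideal_mul_sub => [|u v [p pE] [q qE]|u v /fg[p pE] /fg'[q qE]].
  - by exists 0; rewrite !rmorph0 !mul0r.
  - by exists (p + q); rewrite !rmorphD !mulrDl pE qE.
  by exists (p * q); rewrite !rmorphM mulrACA pE qE; ring.
exists (c * c'); first by rewrite mulf_neq0.
exists (x * y); first exact: mem_ideal_mul.
by rewrite polyCM !rmorphM mulrACA xc yc; ring.
Qed.

Lemma unitary_scaling1 : unitary_scaling (@unit_ideal A) 1 1.
Proof.
split; [exact: monic1|exact: monic1| |].
  by move=> _ [a _ <-]; exists (j a); rewrite iotaF.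
exists 1; first exact: oner_neq0.
by exists 1; [exists 1; rewrite ?tofrac1|rewrite !rmorph1].
Qed.

(** If dI lies in A, let e be the monic generator of the ideal of K[X] generated by dI, and let h be
    d, made monic, over e. Clearing coefficients by [denomA] in an expression of e puts a nonzero
    constant multiple of e in dI itself. *)
Lemma exists_unitary_scaling I : invertible_ideal I ->
  exists f g, unitary_scaling I f g.
Proof.
move=> [[I0 ID IM [d d0 Id]] [J fJ IJ]].
have [x0 Ix0 x00] : exists2 x, I x & x != 0.
  apply: contrapT => nx; have : ideal_mul I J 1.
    by rewrite IJ; exists 1; rewrite ?tofrac1.
  move=> [s [sIJ /eqP]]; rewrite big_seq big1 ?oner_eq0 // => p /sIJ[Ip _].
  apply/eqP; rewrite mulf_eq0; apply/orP; left; apply/negPn/negP => p0.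
  by apply: nx; exists p.1.
have jd0 : j d != 0.
  have dF0 : d%:F != 0 by rewrite tofrac_eq0.
  have := fmorph_eq0 iota d%:F; rewrite iotaF (negbTE dF0) => td.
  by apply: contraFneq td => ->; rewrite rmorph0.
pose T p := exists2 x, I x & iota x * tof (j d) = tof p.
have TI x : I x -> exists2 p, T p & iota x * tof (j d) = tof p.
  move=> Ix; have [a dx] := Id x Ix.
  have E : iota x * tof (j d) = tof (j a).
    by rewrite -!iotaF -dx rmorphM mulrC.
  by exists (j a) => //; exists x.
have [p0 Tp0 p0E] := TI x0 Ix0.
have p00 : p0 != 0.
  rewrite -(inj_eq tof_inj) rmorph0 -p0E mulf_neq0 ?fmorph_eq0 //.
  exact: tof_neq0.
pose pr n := `[< exists2 e, idl T e & e \is monic /\ size e = n >].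
have ex : exists n, pr n.
  exists (size p0); apply/asboolP; exists ((lead_coef p0)^-1%:P * p0).
    exact/idlM/idl_mem.
  split; last by rewrite mul_polyC size_scale // invr_eq0 lead_coef_eq0.
  by rewrite monicE lead_coefM lead_coefC mulVf // lead_coef_eq0.
case: (ex_minnP ex) => n /asboolP[e Te [em en]] nmin.
have e0 := monic_neq0 em.
have ediv p : idl T p -> e %| p.
  move=> Tp; rewrite /dvdp; apply: contraT => r0.
  have rE : p %% e = p + (- (p %/ e)) * e.
    by rewrite {2}(divp_eq p e); ring.
  have : pr (size (p %% e)).
    apply/asboolP; exists ((lead_coef (p %% e))^-1%:P * (p %% e)).
      by apply: idlM; rewrite rE; apply: idlD => //; apply: idlM.
    split; last by rewrite mul_polyC size_scale // invr_eq0 lead_coef_eq0.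
    by rewrite monicE lead_coefM lead_coefC mulVf // lead_coef_eq0.
  by move/nmin; rewrite -en leqNgt ltn_modp e0.
have [c c0 [x Ix xc]] : exists2 c : K, c != 0 & T (c%:P * e).
  have TM a p : T p -> T (j a * p).
    move=> [x Ix xp]; exists (a%:F * x); first exact: IM.
    by rewrite !rmorphM iotaF -mulrA xp.
  have TD p q : T p -> T q -> T (p + q).
    move=> [x Ix xp] [y Iy yq]; exists (x + y); first exact: ID.
    by rewrite !rmorphD mulrDl xp yq.
  (* The constant is kept in the image of [j] so that it may multiply elements of I during the
     induction. *)
  suff [c [a [c0 _ Tc]]] : exists c a, [/\ c != 0, j a = c%:P & T (c%:P * e)].
    by exists c.
  elim: Te => [|k p q Tp _ [c [a [c0 ac Tq]]]].
    exists 1, 1; rewrite rmorph1 oner_neq0 mulr0; split=> //.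
    by exists 0; rewrite // !rmorph0 mul0r.
  have [c' [a' [b [c'0 ac' bk]]]] := denomA k.
  exists (c * c'), (a * a'); split; first by rewrite mulf_neq0.
    by rewrite rmorphM ac ac' polyCM.
  rewrite (_ : _ * _ = j a * (j b * p) + j a' * (c%:P * q)).
    by apply: TD; [apply/TM/TM|apply/TM].
  by rewrite ac ac' bk polyCM; ring.
pose l := lead_coef (j d).
have l0 : l != 0 by rewrite lead_coef_eq0.
have lP : tof l%:P != 0 by apply: tof_neq0; rewrite polyC_eq0.
have fE : l^-1%:P * j d \is monic.
  by rewrite monicE lead_coefM lead_coefC mulVf.
exists (l^-1%:P * j d), e; split=> //.
  move=> y Iy; have [p Tp pE] := TI y Iy.
  have /dvdpP[q qE] := ediv p (idl_mem Tp); exists (l^-1%:P * q).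
  by rewrite !rmorphM mulrCA pE qE rmorphM mulrA.
exists (l^-1 * c); first by rewrite mulf_neq0 ?invr_eq0.
by exists x => //; rewrite polyCM !rmorphM mulrCA xc rmorphM mulrA.
Qed.

(** By uniqueness for the unit ideal, the scalings of I and J are inverse to each other. *)
Lemma scaled_inverse I J f g f' g' : ideal_mul I J = @unit_ideal A ->
  unitary_scaling I f g -> unitary_scaling J f' g' ->
  forall p q, scaled I f g p -> scaled J f' g' q -> exists a, j a = p * q.
Proof.
move=> IJ If Jf p q [x Ix xp] [y Jy yq].
have := unitary_scaling_mul If Jf; rewrite IJ => /unitary_scaling_unique.
move=> /(_ _ _ unitary_scaling1); rewrite mulr1 mul1r => ffgg.
have [_ gm _ _] := If; have [_ g'm _ _] := Jf.
have [a _ aE] : @unit_ideal A (x * y) by rewrite -IJ; apply: mem_ideal_mul.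
exists a; apply: tof_inj; rewrite -iotaF aE.
have gg0 : tof (g * g') != 0 by rewrite tof_neq0 // mulf_neq0 ?monic_neq0.
apply: (mulIf gg0); rewrite -{1}ffgg !rmorphM mulrACA xp yq; ring.
Qed.

(** Polynomials vanishing at a are excluded, as v 0 carries no meaning. *)
Definition has_scaled_min (v : K -> int) (a : K) I f g (n : int) :=
  (exists p, [/\ scaled I f g p, p.[a] != 0 & v p.[a] = n]) /\
  forall p, scaled I f g p -> p.[a] != 0 -> n <= v p.[a].

Variables (T : Type) (val : T -> K -> int) (pt : T -> K).
Hypothesis valM : forall t (x y : K), x != 0 -> y != 0 ->
  val t (x * y) = val t x + val t y.
Hypothesis valD : forall t (x y : K) (n : int), x != 0 -> y != 0 -> x + y != 0 ->
  n <= val t x -> n <= val t y -> n <= val t (x + y).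
Hypothesis val_bounded :
  forall x : K, x != 0 -> exists N : nat, forall t, (`|val t x| <= N)%N.
Hypothesis mem_A : forall p, (exists a, j a = p) <->
  forall t, p.[pt t] != 0 -> 0 <= val t p.[pt t].

Lemma has_scaled_min_unique v a I f g n m :
  has_scaled_min v a I f g n -> has_scaled_min v a I f g m -> n = m.
Proof.
move=> [[p [Ip p0 <-]] np] [[q [Iq q0 <-]] mq].
by apply/eqP; rewrite eq_le np ?mq.
Qed.

(** Take constants c in hI and d in the scaled inverse. As p d lies in A for p in hI, values are at
    least -v(d), and the minimum is at most v(c). Both bounds are uniform in t. *)
Lemma exists_scaled_min I f g : invertible_ideal I -> unitary_scaling I f g ->
  exists N : nat, forall t, exists2 n,
    has_scaled_min (val t) (pt t) I f g n & (`|n| <= N)%N.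
Proof.
move=> iI If; have iJ := invertible_ideal_inv iI.
have IJ : ideal_mul I (ideal_inv I) = @unit_ideal A.
  by rewrite ideal_mulC ideal_mulV.
have [f' [g' Jf]] := exists_unitary_scaling iJ.
have [_ _ _ [c c0 Ic]] := If; have [_ _ _ [d d0 Jd]] := Jf.
have [Nc cN] := val_bounded c0; have [Nd dN] := val_bounded d0.
exists (Nc + Nd)%N => t.
have low p : scaled I f g p -> p.[pt t] != 0 -> - val t d <= val t p.[pt t].
  move=> Ip p0; have /mem_A /(_ t) := scaled_inverse IJ If Jf Ip Jd.
  rewrite hornerM hornerC mulf_neq0 // valM // => /(_ isT).
  have addle (x y : int) : 0 <= x + y -> - y <= x by lia.
  exact: addle.
pose pr n := `[< exists p, [/\ scaled I f g p, p.[pt t] != 0 &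
                    val t p.[pt t] + val t d = n%:Z] >].
have ex : exists n, pr n.
  exists (absz (val t c + val t d)); apply/asboolP; exists c%:P.
  rewrite hornerC; split=> //; rewrite gez0_abs //.
  by have := low _ Ic; rewrite hornerC => /(_ c0); lia.
case: (ex_minnP ex) => n /asboolP[p [Ip p0 pn]] nmin.
have pmin q : scaled I f g q -> q.[pt t] != 0 -> val t p.[pt t] <= val t q.[pt t].
  move=> Iq q0; have lq := low q Iq q0.
  have : pr (absz (val t q.[pt t] + val t d)).
    by apply/asboolP; exists q; split=> //; rewrite gez0_abs //; lia.
  by move/nmin; lia.
exists (val t p.[pt t]).
  by split=> //; exists p.
have := low p Ip p0; have := pmin _ Ic; rewrite hornerC => /(_ c0).
have := cN t; have := dN t; lia.
Qed.

(** The product of two minimizers has value n + m. Any other element is a sum of products that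
    vanish at the point or have value at least n + m. *)
Lemma has_scaled_min_mul t I J f g f' g' n m :
  unitary_scaling I f g -> unitary_scaling J f' g' ->
  has_scaled_min (val t) (pt t) I f g n ->
  has_scaled_min (val t) (pt t) J f' g' m ->
  has_scaled_min (val t) (pt t) (ideal_mul I J) (f * f') (g * g') (n + m).
Proof.
move=> [_ gm fg _] [_ g'm fg' _] [[p [[x Ix xp] p0 pn]] nmin].
move=> [[q [[y Jy yq] q0 qm]] mmin].
have gg0 : tof (g * g') != 0 by rewrite tof_neq0 // mulf_neq0 ?monic_neq0.
split.
  exists (p * q); split.
  - exists (x * y); first exact: mem_ideal_mul.
    by rewrite !rmorphM mulrACA xp yq; ring.
  - by rewrite hornerM mulf_neq0.
  by rewrite hornerM valM // pn qm.
pose M z := exists2 r, iota z * tof (f * f') = tof r * tof (g * g') &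
  r.[pt t] != 0 -> n + m <= val t r.[pt t].
have IJM : forall z, ideal_mul I J z -> M z.
  apply: ideal_mul_sub => [|u v [r rE rn] [s sE sn]|u v Iu Jv].
  - by exists 0; rewrite ?rmorph0 ?mul0r // horner0 eqxx.
  - exists (r + s); first by rewrite !rmorphD !mulrDl rE sE.
    rewrite hornerD; have [r0|r0] := eqVneq r.[pt t] 0; first by rewrite r0 add0r.
    have [s0|s0] := eqVneq s.[pt t] 0; first by rewrite s0 addr0 => _; apply: rn.
    by move=> rs0; apply: valD; rewrite ?rn ?sn.
  have [r rE] := fg u Iu; have [s sE] := fg' v Jv.
  exists (r * s); first by rewrite !rmorphM mulrACA rE sE; ring.
  rewrite hornerM mulf_eq0 => /norP[r0 s0]; rewrite valM // lerD //.
    by apply: nmin => //; exists u.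
  by apply: mmin => //; exists v.
move=> r [z /IJM[s sE sn] zr]; suff -> : r = s by [].
by apply/tof_inj/(mulIf gg0); rewrite -sE -zr.
Qed.

Lemma free_invertible_ideals : free_abelian (InvGroup A).
Proof.
have exfg (I : InvGroup A) : exists fg : B * B, unitary_scaling I fg.1 fg.2.
  by have [f [g If]] := exists_unitary_scaling (InvGroupP I); exists (f, g).
pose fg (I : InvGroup A) := projT1 (cid (exfg I)).
have fgP (I : InvGroup A) : unitary_scaling I (fg I).1 (fg I).2.
  by rewrite /fg; case: cid.
have exmin (I : InvGroup A) t : exists n,
    has_scaled_min (val t) (pt t) I (fg I).1 (fg I).2 n.
  have [N /(_ t)[n nmin _]] := exists_scaled_min (InvGroupP I) (fgP I).
  by exists n.
pose mn (I : InvGroup A) t := projT1 (cid (exmin I t)).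
have mnP (I : InvGroup A) t :
    has_scaled_min (val t) (pt t) I (fg I).1 (fg I).2 (mn I t).
  by rewrite /mn; case: cid.
have monicfg (I : InvGroup A) : (fg I).1 \is monic /\ (fg I).2 \is monic.
  by case: (fgP I).
have fgM (I J : InvGroup A) : (fg I).1 * (fg J).1 * (fg (I * J)%g).2 =
               (fg (I * J)%g).1 * ((fg I).2 * (fg J).2).
  exact: unitary_scaling_unique (unitary_scaling_mul (fgP I) (fgP J))
    (fgP (I * J)%g).
pose Irr := {q : B | irreducible_poly q}.
pose Phi (I : InvGroup A) (x : Irr + T) : int := match x with
  | inl q => (mult (proj1_sig q) (fg I).1)%:Z - (mult (proj1_sig q) (fg I).2)%:Z
  | inr t => mn I t
  end.
have PhiM (I J : InvGroup A) x : Phi (I * J)%g x = Phi I x + Phi J x.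
  case: x => [[q qi]|t] /=; last first.
    (* The pair chosen for the product ideal may differ from the product of the two pairs, but gives
       the same rational function. *)
    apply: (@has_scaled_min_unique (val t) (pt t) (I * J)%g _ _ _ _ (mnP _ t)).
    have [[p [Ip p0 pn]] nmin] :=
      has_scaled_min_mul (fgP I) (fgP J) (mnP I t) (mnP J t).
    have [_ m] := monicfg (I * J)%g.
    have m' : (fg I).2 * (fg J).2 \is monic.
      by case: (monicfg I) => _ ?; case: (monicfg J) => _ ?; rewrite monicMl.
    split.
      by exists p; split=> //; apply: scaled_eq Ip; rewrite ?fgM.
    by move=> q Iq; apply: nmin; apply: scaled_eq Iq; rewrite -?fgM.
  have nz (L : InvGroup A) : (fg L).1 != 0 /\ (fg L).2 != 0.
    by case: (monicfg L) => /monic_neq0 ? /monic_neq0 ?.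
  have [a0 b0] := nz I; have [c0 d0] := nz J; have [e0 f0] := nz (I * J)%g.
  have := congr1 (mult q) (fgM I J).
  rewrite !(multM qi) ?mulf_neq0 //.
  have arith (a b c d e f : nat) : (a + c + f = e + (b + d))%N ->
      e%:Z - f%:Z = a%:Z - b%:Z + (c%:Z - d%:Z) by lia.
  exact: arith.
apply: (bounded_free PhiM); last first.
  move=> I; have [N NP] := exists_scaled_min (InvGroupP I) (fgP I).
  exists (size (fg I).1 + size (fg I).2 + N)%N => -[[q qi]|t] /=.
    have arith (a b m n : nat) : (a <= m)%N -> (b <= n)%N ->
        (absz (a%:Z - b%:Z) <= m + n + N)%N by lia.
    by apply: arith; apply: mult_leq_size.
  have [n nmin nN] := NP t; rewrite (has_scaled_min_unique (mnP I t) nmin).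
  by rewrite (leq_trans nN) // leq_addl.
(* Zero multiplicities give h = 1, so I consists of polynomials; zero minima make their values
   nonnegative, so they lie in A. *)
have subA (I : InvGroup A) : (forall x, Phi I x = 0) ->
    forall x, InvGroup_val I x -> @unit_ideal A x.
  move=> I0 x Ix; have [fm gm fgI _] := fgP I.
  have fgE : (fg I).1 = (fg I).2.
    apply: monic_eq_mult => // q qi.
    by have := I0 (inl (exist _ q qi)) => /= /eqP; rewrite subr_eq0 => /eqP[].
  have [p pE] := fgI x Ix.
  have xp : iota x = tof p.
    apply/(mulIf (tof_neq0 (monic_neq0 gm))).
    by rewrite -pE fgE.
  have [a aE] : exists a, j a = p.
    apply/mem_A => t pt0; have := I0 (inr t) => /= tn.
    by have [_] := mnP I t; rewrite tn; apply => //; exists x.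
  by exists a => //; apply: (fmorph_inj iota); rewrite iotaF aE xp.
have Phi1 x : Phi 1%g x = 0.
  by apply: (addrI (Phi 1%g x)); rewrite -PhiM mulg1 addr0.
move=> I I0.
have IV0 x : Phi I^-1%g x = 0.
  by apply: (addrI (Phi I x)); rewrite -PhiM mulgV Phi1 I0.
have IJ : ideal_mul (InvGroup_val I) (InvGroup_val I^-1%g) = @unit_ideal A.
  by have /(congr1 (@InvGroup_val A)) := mulgV I.
have [[I00 ID IM _] _] := InvGroupP I.
apply: val_inj => /=; apply/seteqP; split; first exact: subA.
(* The inverse of I also lies in A, so A, its product with I, is contained in I. *)
rewrite -[X in (X `<=` _)%classic]IJ.
apply: ideal_mul_sub => // x y Ix /(subA _ IV0)[a _ <-].
by rewrite mulrC; apply: IM.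
Qed.
End ValuedPolynomialRing.

(** * Integer-valued polynomials *)

Lemma poly_denominator (D : idomainType) (K : fieldType)
    (phi : {rmorphism D -> K}) :
  injective phi -> (forall z, exists a b, b != 0 /\ z = phi a / phi b) ->
  forall p : {poly K}, exists c, c != 0 /\
    exists q : {poly D}, map_poly phi q = (phi c)%:P * p.
Proof.
move=> phi_inj frac p; elim/poly_ind: p => [|p z [c [c0 [q qE]]]].
  by exists 1; rewrite oner_neq0; split=> //; exists 0; rewrite map_poly0 mulr0.
have [a [b [b0 ->]]] := frac z.
have phib0 : phi b != 0 by rewrite -(rmorph0 phi) (inj_eq phi_inj).
exists (c * b); split; first by rewrite mulf_neq0.
exists (b *: (q * 'X) + (c * a)%:P).
rewrite rmorphD /= map_polyZ [map_poly phi (q * _)]rmorphM /= map_polyX qE.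
rewrite map_polyC /= !rmorphM.
rewrite -mul_polyC mulrDr; congr (_ + _); first by rewrite -!mulrA mulrCA.
by rewrite -!polyCM; congr (_%:P); rewrite -mulrA (mulrC (phi b)) divfK.
Qed.

(** Constants from D and polynomials with coefficients in D are integer-valued, so a common
    denominator of the coefficients works. *)
Lemma int_poly_denominator (D : idomainType) (p : {poly {fraction D}}) :
  exists c (a b : int_poly D),
    [/\ c != 0, val a = c%:P & val b = c%:P * p].
Proof.
have tof_inj : injective (@FracField.tofrac D).
  by move=> a b /eqP; rewrite tofrac_eq => /eqP.
have [c [c0 [q qE]]] := poly_denominator tof_inj (@fracP D) p.
have cP : c%:F%:P \in @integer_valued D.
  by apply/integer_valuedP => e; exists c; rewrite hornerC.
have qP : c%:F%:P * p \in @integer_valued D.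
  by apply/integer_valuedP => e; exists q.[e]; rewrite -qE horner_map.
by exists c%:F, (IntPoly cP), (IntPoly qP); rewrite tofrac_eq0.
Qed.

Theorem corollary7p5 (D : idomainType) (hD : dedekind_domain D)
    (hnf : ~ GRing.field_axiom D) :
  free_abelian (InvGroup (int_poly D)).
Proof.
have [V [Vval Vmem Vbd]] := dedekind_valuations hD.
pose j : {rmorphism int_poly D -> {poly {fraction D}}} :=
  (val : int_poly D -> {poly {fraction D}}).
have [iota iotaF] := @fraction_morphism _ _ j val_inj.
have tof_inj : injective (@FracField.tofrac {poly {fraction D}}).
  by move=> p q /eqP; rewrite tofrac_eq => /eqP.
(* An index is a valuation with an evaluation point. Integer-valued means nonnegative valuations of
   every nonzero p(d). *)
pose T : Type := ({v | V v} * D)%type.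
apply: (@free_invertible_ideals _ _ _ j _ iota tof_inj iotaF
  (@int_poly_denominator D) T (fun t => proj1_sig t.1) (fun t => t.2%:F)).
- by move=> [[v /= /Vval[]]].
- by move=> [[v /= /Vval[]]].
- by move=> x /Vbd[N NP]; exists N => -[[v Vv] d]; apply: NP.
move=> p; split=> [[a <-] [[v Vv] d] /=|pV].
  have /integer_valuedP/(_ d)[e ->] := valP a.
  by rewrite tofrac_eq0; have [_ _] := Vval v Vv; apply.
have pI : p \in @integer_valued D.
  apply/integer_valuedP => d; have [pd|pd] := eqVneq p.[d%:F] 0.
    by exists 0; rewrite pd tofrac0.
  by apply: Vmem => // v Vv; apply: (pV (exist _ v Vv, d)).
by exists (IntPoly pI).
Qed.
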